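(* Let $(X_t)_{t\in\mathbf{R}}$ be a time-homogeneous, bilateral Markov process on $\mathbf{R}^n$ with invariant measure $\mu$ and forward and backward generators $(L,D(L))$, $(\tilde L,D(\tilde L))$, satisfying hypotheses 1–4 listed in the context, with $\mu(dx)=\rho(x)\,dx$. Let $S:\mathbf{R}^n\to\mathbf{R}$ be an arbitrary real function, $E\in\mathbf{R}$ a constant, and $$\psi(x)=\sqrt{\rho(x)}\,e^{iS(x)},\qquad \Psi(x,t)=\psi(x)\,e^{-iEt}.$$ With $K$, $K^Y$, $K_\psi$, $K^Y_\Psi$ as defined in the context, the operator $K^Y_\Psi$ can be written as $$K^Y_\Psi=H_0\otimes I_t-iI_0\otimes\partial_t,$$ where $I_0$ and $I_t$ are the identity operators on the $x$ and $t$ variables respectively, while $$H_0=K_\psi+E$$ is a symmetric and bounded from below operator in $\mathcal{L}^2_{\mathbf{C}}(\mathbf{R}^n,dx)$. Moreover $\psi$ is an eigenvector with eigenvalue $E$ of the Friedrichs extension $H$ of $H_0$, $$H\psi(x)=E\psi(x),$$ and the function $\Psi(x,t)$ is a strong solution of $$i\partial_t\Psi(x,t)=H\Psi(x,t),$$ and for every $t>0$ it also satisfies $H\Psi(\cdot,t)=E\Psi(\cdot,t)$.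
   Context: Markov process and generators. For a bilateral (indexed by $t\in\mathbf{R}$) time-homogeneous Markov process $X$ on $\mathbf{R}^n$, the forward and backward transition functions are $p_t(x,B)=\mathbb{P}\{X_{s+t}\in B\mid X_s=x\}$, $\tilde p_t(x,B)=\mathbb{P}\{X_{s-t}\in B\mid X_s=x\}$ ($s\in\mathbf{R}$, $t\ge0$). A measure $\mu$ is invariant if $\mu(B)=\int p_t(x,B)\mu(dx)=\int\tilde p_t(x,B)\mu(dx)$ for all $t>0$ and all Borel $B$. It is not required to be a probability measure: it may be $\sigma$-finite, in which case $\mu$ is the one-time marginal of an ''improper'' process whose overall measure is not finite. The semigroups $[T_tf](x)=\int f(y)p_t(x,dy)$ and $[\tilde T_tf](x)=\int f(y)\tilde p_t(x,dy)$, $t\ge 0$, act on $\mathcal{L}^2(\mathbf{R}^n,d\mu)$ and satisfy $T_t^\dagger=\tilde T_t$. Their generators are $(L,D(L))$ and $(\tilde L,D(\tilde L))$, so that $\tilde L=L^\dagger$ under hypothesis 3. They are extended naturally to complex-valued functions, i.e. to $\mathcal{L}^2_{\mathbf{C}}(\mathbf{R}^n,d\mu)$, with the same notation. The scalar product $\langle\cdot,\cdot\rangle_\mu$ is linear in the second argument. Hypotheses: 1. $X_t$ has an absolutely continuous invariant measure $\mu(dx)=\rho(x)dx$. 2. $\rho(x)>0$ almost everywhere with respect to Lebesgue measure. 3. $D(L)\cap D(\tilde L)$ is dense in $\mathcal{L}^2(\mathbf{R}^n,d\mu)$. 4. There is $C\in\mathbf{R}$ such that $-\Re\langle\phi,L\phi\rangle_\mu+\Im\langle\phi,L\phi\rangle_\mu\ge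 C\|\phi\|_\mu^2$ for every $\phi\in D(L)$. Space-time version. $Y_t=(X_t,\tau_t)$ with $\tau_t=t$. Its forward and backward generators, on $\mathcal{L}^2_{\mathbf{C}}(\mathbf{R}^{n+1},d\mu\,dt)$, are $L^Y=L+\partial_t$ and $\tilde L^Y=\tilde L-\partial_t$, with $D(L^Y)=D(L)\otimes\mathcal{H}^1$, $D(\tilde L^Y)=D(\tilde L)\otimes\mathcal{H}^1$, where $\mathcal{H}^1$ is the space of absolutely continuous functions of $t$ with square integrable derivative; they satisfy $\tilde L^Y=(L^Y)^\dagger$. Operators. $$K^Y=-\frac{L^Y+\tilde L^Y}{2}+\frac{L^Y-\tilde L^Y}{2i},\quad D(K^Y)=D(L^Y)\cap D(\tilde L^Y),$$ $$K=-\frac{L+\tilde L}{2}+\frac{L-\tilde L}{2i},\quad D(K)=D(L)\cap D(\tilde L).$$ The maps $U_\Psi:f\mapsto f\Psi$ from $\mathcal{L}^2_{\mathbf{C}}(\mathbf{R}^{n+1},d\mu\,dt)$ to $\mathcal{L}^2_{\mathbf{C}}(\mathbf{R}^{n+1},dx\,dt)$ and $U_\psi:f\mapsto f\psi$ from $\mathcal{L}^2_{\mathbf{C}}(\mathbf{R}^n,d\mu)$ to $\mathcal{L}^2_{\mathbf{C}}(\mathbf{R}^n,dx)$ are unitary. Define the (Doob) transforms $K^Y_\Psi=U_\Psi K^YU_\Psi^{-1}$ with $D(K^Y_\Psi)=U_\Psi D(K^Y)$, and $K_\psi=U_\psi KU_\psi^{-1}$ with $D(K_\psi)=U_\psi D(K)$.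 The Friedrichs extension of a densely defined, symmetric operator $H_0$ bounded from below is the standard self-adjoint operator $H$, bounded from below, extending $H_0$.
   Formalization: The claims that ψ is an eigenvector of H and that Ψ is a strong solution with HΨ=EΨ are stated for finite μ, since ‖ψ‖²=μ(Rⁿ) and ψ is otherwise not in L² (e.g. Brownian motion with Lebesgue measure); S is taken measurable so that ψ makes sense. *)

(* Defs.v *)
From HB Require Import structures.
From mathcomp Require Import all_boot all_order all_algebra.
From mathcomp Require Import complex.
From mathcomp Require Import all_classical all_reals all_analysis.
Set Implicit Arguments.
Unset Strict Implicit.
Unset Printing Implicit Defensive.
Import Order.TTheory GRing.Theory Num.Theory.
Import numFieldNormedType.Exports.
Local Open Scope classical_set_scope.
Local Open Scope complex_scope.
Local Open Scope ring_scope.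

(** Lebesgue measure on R^n, where R^n is [n.-tuple R] with its product
    (= Borel) sigma-algebra.  [lebesgue_tuple n.+1] is the image of
    (Lebesgue on R^n) x (Lebesgue on R) under ((x_1, .., x_n), a) |->
    (a, x_1, .., x_n), and Lebesgue measure on R^0 is the unit mass. *)
Section lebesgue_tuple.
Context {R : realType}.

Definition tuple_cons (n : nat) (z : n.-tuple R * R) : n.+1.-tuple R :=
  [tuple of z.2 :: z.1].

Lemma measurable_tuple_cons n :
  measurable_fun [set: n.-tuple R * R] (@tuple_cons n).
Proof. exact: measurable_cons measurable_snd measurable_fst. Qed.

Fixpoint lebesgue_tuple (n : nat) : {measure set (n.-tuple R) -> \bar R} :=
  match n with
  | 0 => \d_([tuple] : 0.-tuple R)
  | m.+1 =>
      (* [pushforward (lebesgue_tuple m \x lebesgue_measure) (@tuple_cons m)]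
         with its structure of measure *)
      measure_function_pushforward__canonical__measure_function_Measure
        (lebesgue_tuple m \x @lebesgue_measure R)%E (@measurable_tuple_cons m)
  end.

End lebesgue_tuple.

(** Complex L^2 spaces and unbounded operators.  Elements of L^2_C(mu) are
    represented by measurable functions, equality being mu-almost everywhere.
    An operator is its graph, a set of pairs (f, A f). *)
Section complex_L2.
Context {R : realType} {d : measure_display} {T : measurableType d}.
Variable mu : {measure set T -> \bar R}.

Definition L2C (f : T -> R[i]) : Prop :=
  (fun x => complex.Re (f x)) \in Lfun mu 2%:E /\
  (fun x => complex.Im (f x)) \in Lfun mu 2%:E.

Definition norm2 (f : T -> R[i]) : \bar R :=
  'N[mu]_2%:E[(fun x => (Normc.normc (f x))%:E)]%E.

Definition cintegral (f : T -> R[i]) : R[i] :=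
  (\int[mu]_x complex.Re (f x)) +i* (\int[mu]_x complex.Im (f x)).

(** Linear in the second argument. *)
Definition inner (f g : T -> R[i]) : R[i] :=
  cintegral (fun x => (f x)^* * g x).

Definition oper := set ((T -> R[i]) * (T -> R[i])).

Definition dom (A : oper) : set (T -> R[i]) := [set f | exists g, A (f, g)].

(** The operator on L^2_C(mu) determined by a relation between functions
    given up to equality almost everywhere. *)
Definition ae_closure (A : oper) : oper :=
  [set F | [/\ L2C F.1, L2C F.2 &
    exists f g, [/\ A (f, g), F.1 = f %[ae mu] & F.2 = g %[ae mu]]]].

Definition is_operator (A : oper) : Prop :=
  [/\ forall f g, A (f, g) -> L2C f /\ L2C g,
      ae_closure A `<=` A,
      A (fun=> 0, fun=> 0),
      forall (a : R[i]) f1 g1 f2 g2, A (f1, g1) -> A (f2, g2) ->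
        A (fun x => a * f1 x + f2 x, fun x => a * g1 x + g2 x) &
      forall f g1 g2, A (f, g1) -> A (f, g2) -> g1 = g2 %[ae mu]].

Definition dense_in_L2C (D : set (T -> R[i])) : Prop :=
  forall f, L2C f -> forall e : R, 0 < e ->
    exists2 h, D h & (norm2 (fun x => f x - h x)%R < e%:E)%E.

Definition symmetric_operator (A : oper) : Prop :=
  [/\ is_operator A, dense_in_L2C (dom A) &
      forall f Af g Ag, A (f, Af) -> A (g, Ag) -> inner Af g = inner f Ag].

Definition bounded_below (A : oper) : Prop :=
  exists m : R, forall f Af, A (f, Af) ->
    m * fine (norm2 f) ^+ 2 <= complex.Re (inner f Af).

Definition adjoint (A : oper) : oper :=
  [set F | [/\ L2C F.1, L2C F.2 &
    forall g Ag, A (g, Ag) -> inner Ag F.1 = inner g F.2]].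

(** Completion of D(A), inside L^2_C(mu), for the norm
    <f, A f> + (1 - m) ||f||^2, where m is a lower bound of A: the set of
    L^2-limits of sequences of D(A) that are Cauchy for the form of A. *)
Definition form_domain (A : oper) : set (T -> R[i]) :=
  [set f | L2C f /\ exists u Au : nat -> T -> R[i],
    [/\ forall k, A (u k, Au k),
        norm2 (fun x => u k x - f x) @[k --> \oo] --> 0%E &
        forall e : R, 0 < e -> exists N : nat, forall j k,
          (N <= j)%N -> (N <= k)%N ->
          Normc.normc (inner (fun x => u j x - u k x)
                             (fun x => Au j x - Au k x)) < e]].

(** Friedrichs extension of a densely defined, symmetric operator bounded
    from below: the restriction of the adjoint to the form domain. *)
Definition friedrichs (A : oper) : oper :=
  [set F | adjoint A F /\ form_domain A F.1].

Definition eigenvector (A : oper) (E : R) (f : T -> R[i]) : Prop :=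
  A (f, fun x => E%:C * f x) /\ ~ (f = (fun=> 0) %[ae mu]).

Definition L2_derivative (u : R -> T -> R[i]) (t : R) (v : T -> R[i]) : Prop :=
  L2C v /\
  norm2 (fun x => (h^-1)%:C * (u (t + h) x - u t x) - v x) @[h --> 0^'] --> 0%E.

(** i u'(t) = A u(t) for all t, the derivative being taken in L^2 and u(t)
    being in D(A). *)
Definition strong_schroedinger_solution (A : oper) (u : R -> T -> R[i]) : Prop :=
  forall t : R, L2C (u t) /\
    exists v, L2_derivative u t v /\ A (u t, fun x => 'i%C * v x).

Definition scale_op (c : R[i]) (A : oper) : oper :=
  [set F | exists2 g, A (F.1, g) & F.2 = (fun x => c * g x)].

Definition shift_op (A : oper) (E : R) : oper :=
  [set F | exists2 g, A (F.1, g) & F.2 = (fun x => g x + E%:C * F.1 x)].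

(** -(A + B)/2 + (A - B)/(2i), with domain D(A) `&` D(B). *)
Definition K_op (A B : oper) : oper :=
  [set F | exists a b, [/\ A (F.1, a), B (F.1, b) &
    F.2 = (fun x => - (a x + b x) / 2%:R + (a x - b x) / (2%:R * 'i%C))]].

(** U_psi A U_psi^-1, with domain U_psi D(A), U_psi being the multiplication
    by psi from the space on which A acts to L^2_C(mu). *)
Definition doob_transform (psi : T -> R[i]) (A : oper) : oper :=
  ae_closure [set F | exists f g, [/\ A (f, g),
    F.1 = (fun x => f x * psi x) & F.2 = (fun x => g x * psi x)]].

(** Complexification of an operator acting on real-valued functions. *)
Definition complexify (A : set ((T -> R) * (T -> R))) : oper :=
  [set F | A (fun x => complex.Re (F.1 x), fun x => complex.Re (F.2 x)) /\
           A (fun x => complex.Im (F.1 x), fun x => complex.Im (F.2 x))].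

Definition dense_in_L2 (D : set (T -> R)) : Prop :=
  forall f, f \in Lfun mu 2%:E -> forall e : R, 0 < e ->
    exists2 h, D h & ('N[mu]_2%:E[(fun x => (f x - h x)%:E)] < e%:E)%E.

End complex_L2.

Arguments oper R {d} T.

(** A (x) I + I (x) B, whose domain is the algebraic tensor product
    D(A) (x) D(B), the linear span of the f(x) g(t) with f in D(A) and
    g in D(B). *)
Definition tensor_sum {R : realType} {d1 d2 : measure_display}
    {T1 : measurableType d1} {T2 : measurableType d2}
    (m1 : {measure set T1 -> \bar R})
    (m2 : {sigma_finite_measure set T2 -> \bar R})
    (A : oper R T1) (B : oper R T2) : oper R (T1 * T2)%type :=
  ae_closure (m1 \x m2)%E
    [set F | exists (m : nat) (f Af : 'I_m -> T1 -> R[i])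
                    (g Bg : 'I_m -> T2 -> R[i]),
      [/\ forall k, A (f k, Af k),
          forall k, B (g k, Bg k),
          F.1 = (fun z => \sum_(k < m) f k z.1 * g k z.2) &
          F.2 = (fun z => \sum_(k < m)
                   (Af k z.1 * g k z.2 + f k z.1 * Bg k z.2))]].

(** The time derivative, with domain H^1. *)
Section time_derivative.
Context {R : realType}.

Definition absolutely_continuous_on (a b : R) (f : R -> R) : Prop :=
  forall e : R, 0 < e -> exists2 del : R, 0 < del &
    forall (m : nat) (s t : 'I_m -> R),
      (forall k, [/\ a <= s k, s k <= t k & t k <= b]) ->
      (forall j k, j != k -> t j <= s k \/ t k <= s j) ->
      \sum_(k < m) (t k - s k) < del ->
      \sum_(k < m) `|f (t k) - f (s k)| < e.

Definition time_deriv_real : set ((R -> R) * (R -> R)) :=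
  [set F | [/\ F.1 \in Lfun (@lebesgue_measure R) 2%:E,
               F.2 \in Lfun (@lebesgue_measure R) 2%:E &
    exists f : R -> R,
      [/\ F.1 = f %[ae (@lebesgue_measure R)],
          forall a b : R, absolutely_continuous_on a b f &
          \forall t \ae (@lebesgue_measure R), is_derive (t : R) (1 : R) f (F.2 t)]]].

Definition time_deriv : oper R R := complexify time_deriv_real.

End time_derivative.

(** Markov processes indexed by the real line. *)
Section markov_process.
Context {R : realType} {d : measure_display} {T : measurableType d}.

(** [p t x B] is the transition function for t >= 0; its values for t < 0 are
    not used. *)
Definition transition_function := R -> R.-pker T ~> T.

Definition sigma_generated {dO : measure_display} {Omega : measurableType dO}
    (X : R -> Omega -> T) (I : set R) : set (set Omega) :=
  <<s \bigcup_(u in I) preimage_set_system setT (X u) measurable >>.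

(** X is a time-homogeneous Markov process with forward and backward
    transition functions p and q:
      P (X_(s+t) \in B | X_u, u <= s) = p_t(X_s, B),
      P (X_(s-t) \in B | X_u, u >= s) = q_t(X_s, B).
    P is the overall measure of the process; it is not required to be
    finite. *)
Definition is_markov_process {dO : measure_display} {Omega : measurableType dO}
    (P : {measure set Omega -> \bar R}) (X : R -> Omega -> T)
    (p q : transition_function) : Prop :=
  [/\ forall s, measurable_fun setT (X s),
      forall (s t : R) (A : set Omega) (B : set T), 0 <= t ->
        sigma_generated X [set u | u <= s] A -> measurable B ->
        P (A `&` X (s + t) @^-1` B) = (\int[P]_(w in A) p t (X s w) B)%E &
      forall (s t : R) (A : set Omega) (B : set T), 0 <= t ->
        sigma_generated X [set u | s <= u] A -> measurable B ->
        P (A `&` X (s - t) @^-1` B) = (\int[P]_(w in A) q t (X s w) B)%E].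

Definition one_time_marginal {dO : measure_display} {Omega : measurableType dO}
    (P : {measure set Omega -> \bar R}) (X : R -> Omega -> T)
    (mu : {measure set T -> \bar R}) : Prop :=
  forall (s : R) (B : set T), measurable B -> P (X s @^-1` B) = mu B.

Definition invariant_measure (p q : transition_function)
    (mu : {measure set T -> \bar R}) : Prop :=
  forall (t : R) (B : set T), 0 < t -> measurable B ->
    (mu B = \int[mu]_x p t x B)%E /\ (mu B = \int[mu]_x q t x B)%E.

Definition semigroup (p : transition_function) (t : R) (f : T -> R) : T -> R :=
  fun x => \int[p t x]_y f y.

(** Generator of the semigroup [semigroup p] on the real space L^2(mu):
    lim_(t -> 0+) (T_t f - f)/t in L^2(mu), defined where the limit exists. *)
Definition generator (mu : {measure set T -> \bar R}) (p : transition_function) :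
    set ((T -> R) * (T -> R)) :=
  [set F | [/\ F.1 \in Lfun mu 2%:E, F.2 \in Lfun mu 2%:E &
    'N[mu]_2%:E[(fun x =>
      (t^-1 * (semigroup p t F.1 x - F.1 x) - F.2 x)%:E)]%E @[t --> 0^'+]
    --> 0%E]].

Definition generator_dom (mu : {measure set T -> \bar R})
    (p : transition_function) : set (T -> R) :=
  [set f | exists g, generator mu p (f, g)].

End markov_process.

Arguments transition_function R {d} T.

(** e^(i x) *)
Definition expi {R : realType} (x : R) : R[i] := cos x +i* sin x.

(* Main.v *)
(** The forward semigroup of the process and the backward one are adjoint in
    L^2(mu), both matrix elements <g, T_t f> and <T~_t g, f> being the
    expectation of g(X_0) f(X_t); differentiating at t = 0 gives
    <L f, g> = <f, L~ g>.  Hence K is symmetric and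
    <phi, K phi> = - Re <phi, L phi> + Im <phi, L phi>, which hypothesis 4
    bounds from below; both facts are carried to L^2(dx) by the isometry
    f |-> f psi.

    On the space-time domain, K^Y sum_j phi_j (x) h_j =
    sum_j (K phi_j (x) h_j - i phi_j (x) h_j'), because
    (D(L) (x) H^1) /\ (D(L~) (x) H^1) = (D(L) /\ D(L~)) (x) H^1.  Multiplication
    of h_j by e^(-iEt) turns - i d/dt into - i d/dt + E, and this E is the one
    of H_0 = K_psi + E.

    If mu is finite, the constant 1 is in both domains with L 1 = L~ 1 = 0.
    Thus K_psi psi = 0, i.e. H_0 psi = E psi, and H extends H_0. *)

Require Import Defs.
From HB Require Import structures.
From mathcomp Require Import all_boot all_order all_algebra.
From mathcomp Require Import complex.
From mathcomp Require Import all_classical all_reals all_analysis measurable_realfun.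
From mathcomp Require Import ring lra.
Set Implicit Arguments.
Unset Strict Implicit.
Unset Printing Implicit Defensive.
Import Order.TTheory GRing.Theory Num.Theory.
Import numFieldNormedType.Exports.
Local Open Scope classical_set_scope.
Local Open Scope complex_scope.
Local Open Scope ring_scope.

(** * Mixtures of measures *)

(** Three points shape the proof. In the lemmas [P] and [mu] are plain measures, so exchanges of
    integrals rest on one identity for mixtures m(B) = \int k(x, B) nu(dx), obtained by monotone
    convergence; densities, product measures, invariance and transition laws are all instances of
    it. Next, elements of L^2 are genuine functions compared almost everywhere: every operator has
    to be shown closed under changes on null sets and single-valued modulo them. Even linearity of
    the semigroup holds only almost everywhere, since a function of L^2(mu) is integrable against
    p_t(x, .) only for mu-almost every x. Finally, the space-time domains are algebraic tensor
    products, so the intersection of two of them is a matter of linear algebra: over linearly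
    independent time factors, the space factors are unique almost everywhere. Of the relation
    between the two generators only the formal adjointness <L f, g> = <f, L~ g> on their domains is
    established; the symmetry of K and the formula for <phi, K phi> follow from it. *)

Section mixture.
Local Open Scope ereal_scope.
Context {R : realType} {d1 d2 : measure_display}
  {T1 : measurableType d1} {T2 : measurableType d2}.
Variables (nu : {measure set T1 -> \bar R}) (k : T1 -> {measure set T2 -> \bar R})
  (m : {measure set T2 -> \bar R}).
Hypothesis mk : forall B, measurable B -> measurable_fun [set: T1] (k ^~ B).
Hypothesis mE : forall B, measurable B -> m B = \int[nu]_x (k x B).
Import HBNNSimple.

Let integral_mixture_nnsfun (f : {nnsfun T2 >-> R}) :
  \int[m]_y (f y)%:E = \int[nu]_x \int[k x]_y (f y)%:E.
Proof.
rewrite integralT_nnsfun sintegralE.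
under [RHS]eq_integral do rewrite integralT_nnsfun sintegralE.
have mr r : measurable_fun setT (fun x => k x (f @^-1` [set r])) by exact: mk.
rewrite [RHS]ge0_integral_fsum//; last 2 first.
- by move=> r; exact: measurable_funeM.
- by move=> r x _; exact: nnsfun_mulemu_ge0.
apply: eq_fsbigr => r _; rewrite mE//.
have [r0|r0] := leP 0%R r; first by rewrite ge0_integralZl.
rewrite preimage_nnfun0//; under [X in _ * X]eq_integral do rewrite measure0.
by rewrite integral0 mule0; under eq_integral do rewrite measure0 mule0;
  rewrite integral0.
Qed.

(** For simple functions this is additivity; monotone convergence then acts twice, inside each [k x]
    and over [nu]. *)
Lemma ge0_integral_mixture (f : T2 -> \bar R) :
  measurable_fun setT f -> (forall y, 0 <= f y) ->
  \int[m]_y f y = \int[nu]_x \int[k x]_y f y.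
Proof.
move=> mf f0; pose g := nnsfun_approx measurableT mf.
have lim_g (mm : {measure set T2 -> \bar R}) :
    \int[mm]_y (g n y)%:E @[n --> \oo] --> \int[mm]_y f y.
  rewrite (_ : integral _ _ _ = \int[mm]_y limn (fun n => (g n y)%:E)); last first.
    by apply: eq_integral => y _; apply/esym/cvg_lim => //; exact: cvg_nnsfun_approx.
  apply: cvg_monotone_convergence => //.
  - by move=> n; exact/measurable_EFinP.
  - by move=> n y _; rewrite lee_fin.
  - by move=> y _ a b ab; rewrite lee_fin; exact/lefP/nd_nnsfun_approx.
suff lim_m : \int[m]_y (g n y)%:E @[n --> \oo] -->
    \int[nu]_x \int[k x]_y f y by exact: cvg_unique (lim_g m) lim_m.
rewrite (_ : integral nu _ _ =
    \int[nu]_x limn (fun n => \int[k x]_y (g n y)%:E)); last first.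
  by apply: eq_integral => x _; apply/esym/cvg_lim => //; exact: lim_g.
under eq_cvg do rewrite integral_mixture_nnsfun.
apply: cvg_monotone_convergence => //.
- move=> n; apply: measurable_fun_integral_kernel => //.
  + by move=> y; rewrite lee_fin.
  + exact/measurable_EFinP.
- by move=> n x _; apply: integral_ge0 => y _; rewrite lee_fin.
- move=> x _ a b ab; apply: ge0_le_integral => //.
  + by move=> y _; rewrite lee_fin.
  + exact/measurable_EFinP.
  + exact/measurable_EFinP.
  + by move=> y _; rewrite lee_fin; exact/lefP/nd_nnsfun_approx.
Qed.

End mixture.

Section density.
Local Open Scope ereal_scope.
Context {R : realType} {d : measure_display} {T : measurableType d}.
Variables (nu m : {measure set T -> \bar R}) (h : T -> R).
Hypothesis mh : measurable_fun setT h.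
Hypothesis h0 : forall x, (0 <= h x)%R.
Hypothesis mE : forall B, measurable B -> m B = \int[nu]_(x in B) (h x)%:E.

(** A measure with density [h] is the mixture over [nu] of the point masses h(x) \d_x. *)
Lemma ge0_integral_density (f : T -> \bar R) :
  measurable_fun setT f -> (forall x, 0 <= f x) ->
  \int[m]_x f x = \int[nu]_x (f x * (h x)%:E).
Proof.
move=> mf f0; pose k x : {measure set T -> \bar R} := mscale (NngNum (h0 x)) \d_x.
have kE x B : k x B = (h x * \1_B x)%:E by [].
rewrite (@ge0_integral_mixture _ _ _ _ _ nu k) //; last 2 first.
- move=> B mB; apply: (@eq_measurable_fun _ _ _ _ _ (fun x => (h x * \1_B x)%:E)).
    by move=> x _; exact/esym/kE.
  by apply/measurable_EFinP; exact: measurable_funM.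
- move=> B mB; rewrite mE// [LHS]integral_mkcond.
  by apply: eq_integral => x _; rewrite kE epatch_indic EFinM.
apply: eq_integral => x _; rewrite ge0_integral_mscale// integral_dirac//.
by rewrite diracT mul1e muleC.
Qed.

End density.

Section product.
Local Open Scope ereal_scope.
Context {R : realType} {d1 d2 : measure_display}
  {T1 : measurableType d1} {T2 : measurableType d2}.
Variables (m1 : {measure set T1 -> \bar R})
  (m2 : {sigma_finite_measure set T2 -> \bar R}).

(* [fubini_tonelli1] asks [m1] to be sigma-finite. *)
Lemma ge0_integral_prod (f : T1 * T2 -> \bar R) :
  measurable_fun setT f -> (forall z, 0 <= f z) ->
  \int[m1 \x m2]_z f z = \int[m1]_x \int[m2]_y f (x, y).
Proof.
move=> mf f0.
(* The product measure is the mixture over [m1] of the images of [m2] under y |-> (x, y). *)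
pose k x : {measure set (T1 * T2) -> \bar R} :=
  measure_function_pushforward__canonical__measure_function_Measure
    m2 (pair1_measurable x).
have kE x B : k x B = m2 (xsection B x).
  by rewrite /= /pushforward; congr (m2 _); apply/seteqP; split => y;
    rewrite /xsection/= inE.
rewrite (@ge0_integral_mixture _ _ _ _ _ m1 k) //; last 2 first.
- move=> B mB; apply: (@eq_measurable_fun _ _ _ _ _ (m2 \o xsection B)).
    by move=> x _; exact/esym/kE.
  exact: measurable_fun_xsection.
- by move=> B mB; apply: eq_integral => x _; rewrite kE.
apply: eq_integral => x _; rewrite ge0_integral_pushforward//.
Qed.

(** The measure of an exceptional set N is the integral over x of the measure of its section at x;
    if it is zero, almost every section is null. *)
Lemma ae_prod (P : T1 * T2 -> Prop) :
  (\forall z \ae (m1 \x m2), P z) ->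
  \forall x \ae m1, \forall y \ae m2, P (x, y).
Proof.
move=> [N [mN N0 PN]].
have mx : measurable_fun setT (m2 \o xsection N) by exact: measurable_fun_xsection.
have /(ae_eq_integral_abs _ measurableT mx) : \int[m1]_x `|(m2 \o xsection N) x| = 0.
  by rewrite -[RHS]N0; apply: eq_integral => x _; rewrite gee0_abs.
apply: filterS => x /(_ I) /= Nx0; exists (xsection N x); split => //.
  exact: measurable_xsection.
by move=> y Pxy; rewrite /xsection/= inE; exact: PN.
Qed.

End product.

(** * L^2 functions *)

Section real_L2.
Context {R : realType} {d : measure_display} {T : measurableType d}.
Variable mu : {measure set T -> \bar R}.
Implicit Types f g : T -> R.

Lemma Lnorm2E f :
  ('N[mu]_2%:E[(fun x => (f x)%:E)] = (\int[mu]_x (f x ^+ 2)%:E) `^ 2^-1)%E.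
Proof.
rewrite unlock; congr (_ `^ _)%E; apply: eq_integral => x _.
by rewrite abse_EFin poweR_EFin powR_mulrn// -normrX ger0_norm// sqr_ge0.
Qed.

Lemma Lfun2P f : f \in Lfun mu 2%:E <->
  measurable_fun setT f /\ (\int[mu]_x (f x ^+ 2)%:E < +oo)%E.
Proof.
have iff0 : ((0 <= \int[mu]_x (f x ^+ 2)%:E)%E).
  by apply: integral_ge0 => x _; rewrite lee_fin sqr_ge0.
split.
  rewrite inE => /andP[]; rewrite !inE/= => mf; rewrite /finite_norm Lnorm2E => fin.
  split => //; apply: (@lty_poweRy _ _ 2^-1) => //.
by move=> [mf fin]; rewrite inE; apply/andP; split; rewrite inE//= /finite_norm Lnorm2E;
  exact: poweR_lty.
Qed.

Lemma Lfun2_measurable f : f \in Lfun mu 2%:E -> measurable_fun setT f.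
Proof. by move=> /Lfun2P[]. Qed.

Lemma ge0_integral_lty_le (f g : T -> R) : measurable_fun setT f -> measurable_fun setT g ->
  (forall x, 0 <= f x <= g x) -> (\int[mu]_x (g x)%:E < +oo)%E ->
  (\int[mu]_x (f x)%:E < +oo)%E.
Proof.
move=> mf mg fg; apply: le_lt_trans; apply: ge0_le_integral => //.
- by move=> x _; rewrite lee_fin; have /andP[] := fg x.
- exact/measurable_EFinP.
- exact/measurable_EFinP.
- by move=> x _; rewrite lee_fin; have /andP[] := fg x.
Qed.

Lemma Lfun2_lin (a b : R) f g : f \in Lfun mu 2%:E -> g \in Lfun mu 2%:E ->
  (fun x => a * f x + b * g x) \in Lfun mu 2%:E.
Proof.
move=> /Lfun2P[mf fin] /Lfun2P[mg gin]; apply/Lfun2P.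
have mab : measurable_fun setT (fun x => a * f x + b * g x).
  by apply: measurable_funD; exact: measurable_funM.
split => //.
(* The majorant comes from (a f - b g)^2 >= 0. *)
apply: (@ge0_integral_lty_le _ (fun x => (a ^+ 2 *+ 2) * f x ^+ 2 + (b ^+ 2 *+ 2) * g x ^+ 2)).
- exact: measurable_funX.
- by apply: measurable_funD; apply: measurable_funM => //; exact: measurable_funX.
- move=> x; rewrite sqr_ge0/=.
  have := sqr_ge0 (a * f x - b * g x); nra.
under eq_integral do rewrite EFinD !(EFinM (_ *+ 2)).
rewrite ge0_integralD//=; last 4 first.
- by move=> x _; rewrite mule_ge0// lee_fin ?sqr_ge0// mulrn_wge0// sqr_ge0.
- by apply: measurable_funeM; apply/measurable_EFinP; exact: measurable_funX.
- by move=> x _; rewrite mule_ge0// lee_fin ?sqr_ge0// mulrn_wge0// sqr_ge0.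
- by apply: measurable_funeM; apply/measurable_EFinP; exact: measurable_funX.
rewrite !ge0_integralZl//; last 6 first.
- by apply/measurable_EFinP; exact: measurable_funX.
- by move=> x _; rewrite lee_fin ?sqr_ge0.
- by rewrite lee_fin mulrn_wge0// sqr_ge0.
- by apply/measurable_EFinP; exact: measurable_funX.
- by move=> x _; rewrite lee_fin ?sqr_ge0.
- by rewrite lee_fin mulrn_wge0// sqr_ge0.
by rewrite lte_add_pinfty// lte_mul_pinfty// lee_fin mulrn_wge0// sqr_ge0.
Qed.

Lemma Lfun2D f g : f \in Lfun mu 2%:E -> g \in Lfun mu 2%:E ->
  (fun x => f x + g x) \in Lfun mu 2%:E.
Proof. by move=> /(@Lfun2_lin 1 1) h /h; under eq_fun do rewrite !mul1r. Qed.

Lemma Lfun2Z a f : f \in Lfun mu 2%:E -> (fun x => a * f x) \in Lfun mu 2%:E.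
Proof.
by move=> hf; have := Lfun2_lin a 0 hf hf; under eq_fun do rewrite mul0r addr0.
Qed.

Lemma Lfun2_cst0 : (fun=> 0) \in Lfun mu 2%:E.
Proof.
apply/Lfun2P; split => //; under eq_integral do rewrite expr0n/=.
by rewrite integral0.
Qed.

Lemma Lfun2_integrableM f g : f \in Lfun mu 2%:E -> g \in Lfun mu 2%:E ->
  mu.-integrable setT (fun x => (f x * g x)%:E).
Proof. by move=> hf hg; exact/Lfun1_integrable/(Lfun2_mul_Lfun1 hf hg). Qed.

Lemma LnormB_eq0 f g : measurable_fun setT f -> measurable_fun setT g ->
  ('N[mu]_2%:E[(fun x => (f x - g x)%:E)] = 0)%E -> f = g %[ae mu].
Proof.
move=> mf mg /Lnorm_eq0_eq0 -/(_ _ _)[]//.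
- by apply/measurable_EFinP; exact: measurable_funB.
- move=> A [mA A0 hA]; exists A; split => // x /= /not_implyP[_ fgx].
  by apply: hA => /= /(_ I)[] /eqP; rewrite subr_eq0 => /eqP.
Qed.

Lemma Lnorm_eq_ae f g : measurable_fun setT f -> measurable_fun setT g ->
  f = g %[ae mu] ->
  ('N[mu]_2%:E[(fun x => (f x)%:E)] = 'N[mu]_2%:E[(fun x => (g x)%:E)])%E.
Proof.
move=> mf mg fg; rewrite !Lnorm2E; congr (_ `^ _)%E.
apply: ae_eq_integral => //.
- by apply/measurable_EFinP; exact: measurable_funX.
- by apply/measurable_EFinP; exact: measurable_funX.
- by apply: filterS fg => x /[apply] ->.
Qed.

Lemma Lnorm2Z (a : R) f : measurable_fun setT f ->
  ('N[mu]_2%:E[(fun x => (a * f x)%:E)] = `|a|%:E * 'N[mu]_2%:E[(fun x => (f x)%:E)])%E.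
Proof.
move=> mf; rewrite !Lnorm2E; under eq_integral do rewrite exprMn EFinM.
rewrite ge0_integralZl//; last 3 first.
- by apply/measurable_EFinP; exact: measurable_funX.
- by move=> x _; rewrite lee_fin sqr_ge0.
- by rewrite lee_fin sqr_ge0.
rewrite poweRM ?lee_fin ?sqr_ge0//; last first.
  by apply: integral_ge0 => x _; rewrite lee_fin sqr_ge0.
by rewrite poweR_EFin powR12_sqrt ?sqr_ge0// sqrtr_sqr.
Qed.

End real_L2.

Section complex_L2.
Context {R : realType} {d : measure_display} {T : measurableType d}.
Variable mu : {measure set T -> \bar R}.
Implicit Types f g : T -> R[i].

(** The squared modulus, kept polynomial in the two parts: multiplicativity is a ring identity and
    measurability does not go through a square root. *)
Definition sqn (z : R[i]) : R := complex.Re z ^+ 2 + complex.Im z ^+ 2.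

Definition cmeas f := measurable_fun setT (fun x => complex.Re (f x)) /\
  measurable_fun setT (fun x => complex.Im (f x)).

Lemma sqnE (z : R[i]) : sqn z = Normc.normc z ^+ 2.
Proof. by case: z => a b; rewrite /sqn /= sqr_sqrtr// addr_ge0// sqr_ge0. Qed.

Lemma sqn_ge0 (z : R[i]) : 0 <= sqn z.
Proof. by rewrite addr_ge0// sqr_ge0. Qed.

Lemma sqnM (z w : R[i]) : sqn (z * w) = sqn z * sqn w.
Proof. by case: z w => a b [c e]; rewrite /sqn /=; ring. Qed.

Lemma sqn_eq0 (z : R[i]) : sqn z = 0 -> z = 0.
Proof.
case: z => a b /eqP; rewrite /sqn /= paddr_eq0 ?sqr_ge0// !sqrf_eq0.
by move=> /andP[/eqP -> /eqP ->].
Qed.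

Lemma norm2E f : (norm2 mu f = (\int[mu]_x (sqn (f x))%:E) `^ 2^-1)%E.
Proof. by rewrite /norm2 Lnorm2E; under eq_integral do rewrite -sqnE. Qed.

Lemma cmeas_sqn f : cmeas f -> measurable_fun setT (fun x => sqn (f x)).
Proof. by move=> [mr mi]; apply: measurable_funD; exact: measurable_funX. Qed.

Lemma cmeasM f g : cmeas f -> cmeas g -> cmeas (fun x => f x * g x).
Proof.
have reM (z w : R[i]) : complex.Re (z * w) =
    complex.Re z * complex.Re w - complex.Im z * complex.Im w by case: z w => ? ? [].
have imM (z w : R[i]) : complex.Im (z * w) =
    complex.Re z * complex.Im w + complex.Im z * complex.Re w by case: z w => ? ? [].
move=> [fr fi] [gr gi]; split.
- under eq_fun do rewrite reM.
  by apply: measurable_funB; exact: measurable_funM.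
- under eq_fun do rewrite imM.
  by apply: measurable_funD; exact: measurable_funM.
Qed.

Lemma cmeas_cst (c : R[i]) : cmeas (fun=> c).
Proof. by split. Qed.

Lemma Re_conjc (z : R[i]) : complex.Re z^* = complex.Re z.
Proof. by case: z. Qed.

Lemma Im_conjc (z : R[i]) : complex.Im z^* = - complex.Im z.
Proof. by case: z. Qed.

Lemma cmeas_conj f : cmeas f -> cmeas (fun x => (f x)^*).
Proof.
move=> [fr fi]; split.
- by under eq_fun do rewrite Re_conjc.
- by under eq_fun do rewrite Im_conjc; exact: measurableT_comp.
Qed.

Lemma cmeas_real (h : T -> R) : measurable_fun setT h -> cmeas (fun x => (h x)%:C).
Proof. by split. Qed.

Lemma cmeas_expi (h : T -> R) : measurable_fun setT h -> cmeas (fun x => expi (h x)).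
Proof.
move=> mh; split; rewrite /expi /=.
- by apply: measurableT_comp => //; apply: continuous_measurable_fun; exact: continuous_cos.
- by apply: measurableT_comp => //; apply: continuous_measurable_fun; exact: continuous_sin.
Qed.

Lemma sqn_expi (x : R) : sqn (expi x) = 1.
Proof. by rewrite /sqn /= cos2Dsin2. Qed.

Lemma L2CP f : L2C mu f <-> cmeas f /\ (\int[mu]_x (sqn (f x))%:E < +oo)%E.
Proof.
rewrite /L2C !Lfun2P; split.
  move=> [[mr fr] [mi fi]]; split => //.
  under eq_integral do rewrite EFinD.
  rewrite ge0_integralD//; first exact: lte_add_pinfty.
  - by move=> x _; rewrite lee_fin sqr_ge0.
  - by apply/measurable_EFinP; exact: measurable_funX.
  - by move=> x _; rewrite lee_fin sqr_ge0.
  - by apply/measurable_EFinP; exact: measurable_funX.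
move=> [cf fin]; have [mr mi] := cf; split; split => //.
- apply: ge0_integral_lty_le fin.
  + exact: measurable_funX.
  + exact: cmeas_sqn.
  + by move=> x; rewrite sqr_ge0/= lerDl sqr_ge0.
- apply: ge0_integral_lty_le fin.
  + exact: measurable_funX.
  + exact: cmeas_sqn.
  + by move=> x; rewrite sqr_ge0/= lerDr sqr_ge0.
Qed.

Lemma L2C_cmeas f : L2C mu f -> cmeas f.
Proof. by move=> /L2CP[]. Qed.

Lemma L2CD f g : L2C mu f -> L2C mu g -> L2C mu (fun x => f x + g x).
Proof.
move=> [fr fi] [gr gi]; split.
- by under eq_fun do rewrite raddfD/=; exact: Lfun2D.
- by under eq_fun do rewrite raddfD/=; exact: Lfun2D.
Qed.

Lemma L2CZ (a : R[i]) f : L2C mu f -> L2C mu (fun x => a * f x).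
Proof.
move=> /L2CP[mf ff]; apply/L2CP; split; first by apply: cmeasM => //; exact: cmeas_cst.
under eq_integral do rewrite sqnM EFinM.
rewrite ge0_integralZl// ?lte_mul_pinfty ?lee_fin ?sqn_ge0//.
- by apply/measurable_EFinP; exact: cmeas_sqn.
- by move=> x _; rewrite lee_fin sqn_ge0.
Qed.

Lemma L2CN f : L2C mu f -> L2C mu (fun x => - f x).
Proof. by move=> /(L2CZ (-1)); under eq_fun do rewrite mulN1r. Qed.

Lemma L2CB f g : L2C mu f -> L2C mu g -> L2C mu (fun x => f x - g x).
Proof. by move=> hf hg; apply: L2CD => //; exact: L2CN. Qed.

Lemma L2C0 : L2C mu (fun=> 0).
Proof. by split; exact: Lfun2_cst0. Qed.

Lemma L2C_sum (m : nat) (F : 'I_m -> T -> R[i]) :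
  (forall k, L2C mu (F k)) -> L2C mu (fun x => \sum_(k < m) F k x).
Proof.
elim: m F => [|m IH] F hF; first by under eq_fun do rewrite big_ord0; exact: L2C0.
under eq_fun do rewrite big_ord_recl; apply: L2CD => //; exact: IH.
Qed.

Lemma norm2_lty f : L2C mu f -> (norm2 mu f < +oo)%E.
Proof. by move=> /L2CP[_ fin]; rewrite norm2E; exact: poweR_lty. Qed.

Lemma norm2_fin_num f : L2C mu f -> norm2 mu f \is a fin_num.
Proof. by move=> /norm2_lty; rewrite ge0_fin_numE// /norm2 Lnorm_ge0. Qed.

Lemma norm2Z (a : R[i]) f : cmeas f ->
  (norm2 mu (fun x => a * f x)%R = (Normc.normc a)%:E * norm2 mu f)%E.
Proof.
move=> mf; rewrite !norm2E; under eq_integral do rewrite sqnM EFinM.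
rewrite ge0_integralZl//; last 3 first.
- by apply/measurable_EFinP; exact: cmeas_sqn.
- by move=> x _; rewrite lee_fin sqn_ge0.
- by rewrite lee_fin sqn_ge0.
rewrite poweRM ?lee_fin ?sqn_ge0//; last first.
  by apply: integral_ge0 => x _; rewrite lee_fin sqn_ge0.
by rewrite poweR_EFin powR12_sqrt ?sqn_ge0// sqnE sqrtr_sqr ger0_norm//; case: a => a b; exact: sqrtr_ge0.
Qed.

(** This carries density from real-valued to complex-valued functions; it is |z| <= |Re z| + |Im z|
    followed by Minkowski. *)
Lemma norm2_le_ReIm f : cmeas f ->
  (norm2 mu f <= 'N[mu]_2%:E[(fun x => (complex.Re (f x))%:E)] +
                 'N[mu]_2%:E[(fun x => (complex.Im (f x))%:E)])%E.
Proof.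
move=> mf; have [mr mi] := mf.
(* Absolute values make the cross term in (|Re f| + |Im f|)^2 nonnegative, so that this square
   dominates |f|^2. *)
have -> : ('N[mu]_2%:E[(fun x => (complex.Re (f x))%:E)] =
          'N[mu]_2%:E[EFin \o (fun x => `|complex.Re (f x)|%R)])%E.
  by rewrite !Lnorm2E; under [in RHS]eq_integral do rewrite real_normK ?num_real//.
have -> : ('N[mu]_2%:E[(fun x => (complex.Im (f x))%:E)] =
          'N[mu]_2%:E[EFin \o (fun x => `|complex.Im (f x)|%R)])%E.
  by rewrite !Lnorm2E; under [in RHS]eq_integral do rewrite real_normK ?num_real//.
have mar : measurable_fun setT (fun x => `|complex.Re (f x)|) by exact: measurableT_comp.
have mai : measurable_fun setT (fun x => `|complex.Im (f x)|) by exact: measurableT_comp.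
apply: le_trans (minkowski_EFin mu mar mai (ler1n R 2)).
rewrite norm2E Lnorm2E gt0_ler_poweR//.
- by rewrite in_itv/= leey andbT integral_ge0// => x _; rewrite lee_fin sqn_ge0.
- by rewrite in_itv/= leey andbT integral_ge0// => x _; rewrite lee_fin sqr_ge0.
- apply: ge0_le_integral => //.
  + by move=> x _; rewrite lee_fin sqn_ge0.
  + by apply/measurable_EFinP; exact: cmeas_sqn.
  + by apply/measurable_EFinP; apply: measurable_funX; exact: measurable_funD.
  + move=> x _; rewrite lee_fin /= sqrrD /sqn !real_normK ?num_real//.
    by rewrite lerD2r lerDl mulrn_wge0// mulr_ge0.
Qed.

End complex_L2.

#[local] Arguments inner : simpl never.

(** * Integrals and inner products of complex functions *)

Section inner_product.
Context {R : realType} {d : measure_display} {T : measurableType d}.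
Variable mu : {measure set T -> \bar R}.
Implicit Types f g h : T -> R[i].

Lemma Re_mulc (z w : R[i]) : complex.Re (z * w) =
  complex.Re z * complex.Re w - complex.Im z * complex.Im w.
Proof. by case: z w => ? ? []. Qed.

Lemma Im_mulc (z w : R[i]) : complex.Im (z * w) =
  complex.Re z * complex.Im w + complex.Im z * complex.Re w.
Proof. by case: z w => ? ? []. Qed.

Lemma complex_ext (z w : R[i]) : complex.Re z = complex.Re w ->
  complex.Im z = complex.Im w -> z = w.
Proof. by case: z w => ? ? [] ? ? /= -> ->. Qed.

Definition cintegrable f :=
  mu.-integrable setT (fun x => (complex.Re (f x))%:E) /\
  mu.-integrable setT (fun x => (complex.Im (f x))%:E).

Lemma cintegrable_conjM f g : L2C mu f -> L2C mu g ->
  cintegrable (fun x => (f x)^* * g x).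
Proof.
move=> [fr fi] [gr gi]; split.
- under eq_fun do rewrite Re_mulc Re_conjc Im_conjc mulNr opprK EFinD.
  by apply: integrableD => //; exact: Lfun2_integrableM.
- under eq_fun do rewrite Im_mulc Re_conjc Im_conjc mulNr EFinB.
  by apply: integrableB => //; exact: Lfun2_integrableM.
Qed.

Lemma cintegralD f g : cintegrable f -> cintegrable g ->
  cintegral mu (fun x => f x + g x) = cintegral mu f + cintegral mu g.
Proof.
move=> [fr fi] [gr gi]; apply: complex_ext; rewrite /cintegral raddfD/=.
- rewrite -RintegralD//; apply: eq_Rintegral => x _; exact: raddfD.
- rewrite -RintegralD//; apply: eq_Rintegral => x _; exact: raddfD.
Qed.

Lemma cintegralZ (a : R[i]) f : cintegrable f ->
  cintegral mu (fun x => a * f x) = a * cintegral mu f.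
Proof.
move=> [fr fi]; apply: complex_ext; rewrite /cintegral ?Re_mulc ?Im_mulc/=.
- under eq_Rintegral do rewrite Re_mulc.
  rewrite RintegralB//; last 2 first.
  - exact: integrableZl fr.
  - exact: integrableZl fi.
  by rewrite !RintegralZl.
- under eq_Rintegral do rewrite Im_mulc.
  rewrite RintegralD//; last 2 first.
  - exact: integrableZl fi.
  - exact: integrableZl fr.
  by rewrite !RintegralZl.
Qed.

Lemma innerDr f g h : L2C mu f -> L2C mu g -> L2C mu h ->
  inner mu f (fun x => g x + h x) = inner mu f g + inner mu f h.
Proof.
move=> hf hg hh; rewrite /inner -cintegralD; [|exact: cintegrable_conjM..].
by congr (cintegral mu _); apply/funext => x; rewrite mulrDr.
Qed.

Lemma innerZr (a : R[i]) f g : L2C mu f -> L2C mu g ->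
  inner mu f (fun x => a * g x) = a * inner mu f g.
Proof.
move=> hf hg; rewrite /inner -cintegralZ; last exact: cintegrable_conjM.
by congr (cintegral mu _); apply/funext => x; rewrite mulrCA.
Qed.

Lemma inner_conj f g : L2C mu f -> L2C mu g -> inner mu g f = (inner mu f g)^*.
Proof.
move=> hf hg; have [hr hi] := cintegrable_conjM hf hg.
rewrite /inner /cintegral /=; congr Complex.
- by apply: eq_Rintegral => x _; rewrite !Re_mulc !Re_conjc !Im_conjc; ring.
- rewrite -[RHS]mulN1r -RintegralZl//.
  by apply: eq_Rintegral => x _; rewrite !Im_mulc !Re_conjc !Im_conjc; ring.
Qed.

Lemma innerDl f g h : L2C mu f -> L2C mu g -> L2C mu h ->
  inner mu (fun x => f x + g x) h = inner mu f h + inner mu g h.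
Proof.
move=> hf hg hh; rewrite inner_conj//; last exact: L2CD.
by rewrite innerDr// rmorphD/= -!inner_conj.
Qed.

Lemma innerZl (a : R[i]) f g : L2C mu f -> L2C mu g ->
  inner mu (fun x => a * f x) g = a^* * inner mu f g.
Proof.
move=> hf hg; rewrite inner_conj//; last exact: L2CZ.
by rewrite innerZr// rmorphM/= -!inner_conj.
Qed.

Lemma innerxx f : L2C mu f -> inner mu f f = ((fine (norm2 mu f)) ^+ 2)%:C.
Proof.
move=> hf; have [mf fin] := (L2CP mu f).1 hf.
have int0 : (0 <= \int[mu]_x (sqn (f x))%:E)%E.
  by apply: integral_ge0 => x _; rewrite lee_fin sqn_ge0.
apply: complex_ext => /=.
- rewrite norm2E -(@fineK _ (\int[mu]_x (sqn (f x))%:E)%E); last by rewrite ge0_fin_numE.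
  rewrite poweR_EFin/= powR12_sqrt ?fine_ge0// sqr_sqrtr ?fine_ge0//.
  by apply: eq_Rintegral => x _; rewrite Re_mulc Re_conjc Im_conjc /sqn; ring.
- rewrite (@eq_Rintegral _ _ _ _ _ (fun=> 0)) ?Rintegral_cst ?mul0r// => x _.
  by rewrite Im_mulc Re_conjc Im_conjc; ring.
Qed.

Lemma inner_ae f f' g g' : cmeas f -> cmeas f' -> cmeas g -> cmeas g' ->
  f = f' %[ae mu] -> g = g' %[ae mu] -> inner mu f g = inner mu f' g'.
Proof.
move=> mf mf' mg mg' ff' gg'.
have [h1 h2] := cmeasM (cmeas_conj mf) mg; have [h3 h4] := cmeasM (cmeas_conj mf') mg'.
rewrite /inner /cintegral /Rintegral; congr Complex; congr fine.
- apply: ae_eq_integral => //; try exact/measurable_EFinP.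
  by apply: filterS2 ff' gg' => x + + Dx => -> // ->.
- apply: ae_eq_integral => //; try exact/measurable_EFinP.
  by apply: filterS2 ff' gg' => x + + Dx => -> // ->.
Qed.

Lemma norm2_ae f f' : cmeas f -> cmeas f' -> f = f' %[ae mu] -> norm2 mu f = norm2 mu f'.
Proof.
move=> mf mf' ff'; rewrite !norm2E; congr (_ `^ _)%E.
apply: ae_eq_integral => //.
- by apply/measurable_EFinP; exact: cmeas_sqn.
- by apply/measurable_EFinP; exact: cmeas_sqn.
- by apply: filterS ff' => x /[apply] ->.
Qed.

End inner_product.

Section ae_tools.
Context {R : realType} {d : measure_display} {T : measurableType d}.
Variable mu : {measure set T -> \bar R}.

Lemma ae_sym (U : Type) (f g : T -> U) : f = g %[ae mu] -> g = f %[ae mu].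
Proof. by apply: filterS => x /[apply] ->. Qed.

Lemma ae_trans (U : Type) (f g h : T -> U) :
  f = g %[ae mu] -> g = h %[ae mu] -> f = h %[ae mu].
Proof. by apply: filterS2 => x + + Dx => -> // ->. Qed.

Lemma ae_refl (U : Type) (f : T -> U) : f = f %[ae mu].
Proof. exact: nearW. Qed.

Lemma ae_map2 (U V W : Type) (F : U -> V -> W) (f f' : T -> U) (g g' : T -> V) :
  f = f' %[ae mu] -> g = g' %[ae mu] ->
  (fun x => F (f x) (g x)) = (fun x => F (f' x) (g' x)) %[ae mu].
Proof. by apply: filterS2 => x + + Dx => -> // ->. Qed.

End ae_tools.

(** * Operators given by their graphs *)

Section operators.
Context {R : realType} {d : measure_display} {T : measurableType d}.
Variable mu : {measure set T -> \bar R}.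
Implicit Types (A B : oper R T) (f g : T -> R[i]).

Lemma op_L2C_l A f g : is_operator mu A -> A (f, g) -> L2C mu f.
Proof. by move=> [h _ _ _ _] /h[]. Qed.

Lemma op_L2C_r A f g : is_operator mu A -> A (f, g) -> L2C mu g.
Proof. by move=> [h _ _ _ _] /h[]. Qed.

Lemma op_ae A f g f' g' : is_operator mu A -> A (f, g) -> L2C mu f' -> L2C mu g' ->
  f' = f %[ae mu] -> g' = g %[ae mu] -> A (f', g').
Proof. by move=> [_ h _ _ _] Afg hf' hg' e e'; apply: h; split => //; exists f, g. Qed.

(** Closure of the graph under changes on null sets moves the second pair over [f], where
    single-valuedness applies. *)
Lemma op_uniq A f g f' g' : is_operator mu A -> A (f, g) -> A (f', g') ->
  f = f' %[ae mu] -> g = g' %[ae mu].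
Proof.
move=> opA Afg Afg' ff'; have [_ _ _ _] := opA; apply; first exact: Afg.
apply: (op_ae opA Afg' _ _ ff' (ae_refl _ _)).
- exact: op_L2C_l Afg.
- exact: op_L2C_r Afg'.
Qed.

Lemma op_lin A a f1 g1 f2 g2 : is_operator mu A -> A (f1, g1) -> A (f2, g2) ->
  A (fun x => a * f1 x + f2 x, fun x => a * g1 x + g2 x).
Proof. by move=> [_ _ _ h _]; exact: h. Qed.

Lemma op0 A : is_operator mu A -> A (fun=> 0, fun=> 0).
Proof. by case. Qed.

Lemma opZ A a f g : is_operator mu A -> A (f, g) -> A (fun x => a * f x, fun x => a * g x).
Proof.
move=> opA Afg; have := op_lin a opA Afg (op0 opA).
by under eq_fun do rewrite addr0; under [in X in A (_, X)]eq_fun do rewrite addr0.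
Qed.

Lemma op_sum A (m : nat) (c : 'I_m -> R[i]) (F G : 'I_m -> T -> R[i]) : is_operator mu A ->
  (forall k, A (F k, G k)) ->
  A (fun x => \sum_(k < m) c k * F k x, fun x => \sum_(k < m) c k * G k x).
Proof.
move=> opA; elim: m c F G => [|m IH] c F G FG.
  under eq_fun do rewrite big_ord0; under [X in A (_, X)]eq_fun do rewrite big_ord0.
  exact: op0.
under eq_fun do rewrite big_ord_recl; under [X in A (_, X)]eq_fun do rewrite big_ord_recl.
by apply: op_lin => //; exact: IH.
Qed.

Lemma ae_closure_L2C A f g : ae_closure mu A (f, g) -> L2C mu f /\ L2C mu g.
Proof. by case. Qed.

Lemma ae_closureK A : ae_closure mu (ae_closure mu A) `<=` ae_closure mu A.
Proof.
move=> [f g] [/= hf hg [f' [g' [[_ _ [f'' [g'' [h e1 e2]]]] e3 e4]]]].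
split => //; exists f'', g''; split => //; first exact: ae_trans e3 e1.
exact: ae_trans e4 e2.
Qed.

Lemma scale_opI (c : R[i]) A f g : A (f, g) -> scale_op c A (f, fun x => c * g x).
Proof. by move=> Afg; exists g. Qed.

(** A change of the value on a null set is carried back to [A] through division by [c]. For c = 0
    the values would all be the exact zero function, and the graph would miss the functions that
    vanish only almost everywhere. *)
Lemma is_operator_scale (c : R[i]) A : c != 0 -> is_operator mu A ->
  is_operator mu (scale_op c A).
Proof.
move=> c0 opA; split.
- move=> f g [g' /= Afg ->]; split; first exact: op_L2C_l Afg.
  by apply: L2CZ; exact: op_L2C_r Afg.
- move=> [f g] [/= hf hg [f' [_ [[g' /= Afg ->] e1 e2]]]].
  exists (fun x => c^-1 * g x) => /=; last first.
    by apply/funext => x; rewrite mulrA mulfV// mul1r.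
  apply: op_ae Afg hf (L2CZ _ hg) e1 _ => //.
  by apply: filterS e2 => x /[apply] ->; rewrite mulrA mulVf// mul1r.
- by exists (fun=> 0); [exact: op0|apply/funext => x /=; rewrite mulr0].
- move=> a f1 _ f2 _ [g1 /= A1 ->] [g2 /= A2 ->].
  exists (fun x => a * g1 x + g2 x); first exact: op_lin.
  by apply/funext => x /=; rewrite mulrDr mulrCA.
- move=> f _ _ [g1 /= A1 ->] [g2 /= A2 ->].
  by have := op_uniq opA A1 A2 (ae_refl _ _); apply: filterS => x /[apply] ->.
Qed.

Lemma shift_opI A (E : R) f g : A (f, g) -> shift_op A E (f, fun x => g x + E%:C * f x).
Proof. by move=> Afg; exists g. Qed.

Lemma shift_opP A (E : R) f g : shift_op A E (f, g) ->
  exists2 g', A (f, g') & g = (fun x => g' x + E%:C * f x).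
Proof. by []. Qed.

Lemma is_operator_shift A (E : R) : is_operator mu A -> is_operator mu (shift_op A E).
Proof.
move=> opA; split.
- move=> f g [g' /= Afg ->]; have hf := op_L2C_l opA Afg; split => //.
  by apply: L2CD; [exact: op_L2C_r Afg|exact: L2CZ].
- move=> [f g] [/= hf hg [f' [_ [[g' /= Afg ->] e1 e2]]]].
  exists (fun x => g x - E%:C * f x) => /=; last first.
    by apply/funext => x; rewrite subrK.
  apply: (op_ae opA Afg hf (L2CB hg (L2CZ _ hf)) e1 _).
  by apply: filterS2 e1 e2 => x + + Dx => -> // ->//; rewrite addrK.
- by exists (fun=> 0); [exact: op0|apply/funext => x /=; rewrite mulr0 addr0].
- move=> a f1 _ f2 _ [g1 /= A1 ->] [g2 /= A2 ->].
  exists (fun x => a * g1 x + g2 x); first exact: op_lin.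
  by apply/funext => x /=; ring.
- move=> f _ _ [g1 /= A1 ->] [g2 /= A2 ->].
  by have := op_uniq opA A1 A2 (ae_refl _ _); apply: filterS => x /[apply] ->.
Qed.

(* [- 1 / 2 + 1 / (2 i)]; its conjugate is [- 1 / 2 - 1 / (2 i)]. *)
Definition K_coef : R[i] := (- 2^-1) +i* (- 2^-1).

Lemma K_opE (a b : R[i]) :
  - (a + b) / 2%:R + (a - b) / (2%:R * 'i%C) = K_coef * a + K_coef^* * b.
Proof. by case: a b => a1 a2 [b1 b2]; apply: complex_ext => /=; field. Qed.

Lemma K_coef_neq0 : K_coef != 0.
Proof. by rewrite eq_complex /= oppr_eq0 invr_eq0 pnatr_eq0. Qed.

Lemma K_opP A B f Kf : K_op A B (f, Kf) -> exists a b,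
  [/\ A (f, a), B (f, b) & Kf = (fun x => K_coef * a x + K_coef^* * b x)].
Proof.
move=> [a [b [/= Afa Bfb ->]]]; exists a, b; split => //.
by apply/funext => x; rewrite K_opE.
Qed.

Lemma K_opI A B f a b : A (f, a) -> B (f, b) ->
  K_op A B (f, fun x => K_coef * a x + K_coef^* * b x).
Proof. by move=> Afa Bfb; exists a, b; split => //; apply/funext => x; rewrite K_opE. Qed.

Lemma is_operator_K A B : is_operator mu A -> is_operator mu B ->
  is_operator mu (K_op A B).
Proof.
move=> opA opB; split.
- move=> f g /K_opP[a [b [Afa Bfb ->]]]; split; first exact: op_L2C_l Afa.
  by apply: L2CD; apply: L2CZ; [exact: op_L2C_r Afa|exact: op_L2C_r Bfb].
- move=> [f g] [/= hf hg [f' [_ [/K_opP[a [b [Afa Bfb ->]]] e1 e2]]]].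
  (* the value on [f] may only be altered on a null set, and it is altered
     through the first summand *)
  pose a' x := K_coef^-1 * (g x - K_coef^* * b x).
  have hb := op_L2C_r opB Bfb.
  rewrite (_ : g = fun x => K_coef * a' x + K_coef^* * b x); last first.
    by apply/funext => x; rewrite /a' mulrA mulfV ?K_coef_neq0// mul1r subrK.
  apply: K_opI.
  + apply: (op_ae opA Afa hf _ e1); first by apply/L2CZ/L2CB => //; exact: L2CZ.
    by apply: filterS e2 => x /[apply] e; rewrite /a' e addrK mulrA mulVf ?K_coef_neq0// mul1r.
  + exact: (op_ae opB Bfb hf hb e1 (ae_refl _ _)).
- have := K_opI (op0 opA) (op0 opB); congr (K_op A B (_, _)).
  by apply/funext => x; rewrite !mulr0 addr0.
- move=> s f1 _ f2 _ /K_opP[a1 [b1 [A1 B1 ->]]] /K_opP[a2 [b2 [A2 B2 ->]]].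
  have := K_opI (op_lin s opA A1 A2) (op_lin s opB B1 B2).
  by congr (K_op A B (_, _)); apply/funext => x; ring.
- move=> f _ _ /K_opP[a1 [b1 [A1 B1 ->]]] /K_opP[a2 [b2 [A2 B2 ->]]].
  have := op_uniq opA A1 A2 (ae_refl _ _); have := op_uniq opB B1 B2 (ae_refl _ _).
  by apply: filterS2 => x + + Dx => -> // ->.
Qed.

Section adjoint_pair.
Variables A B : oper R T.
Hypotheses (opA : is_operator mu A) (opB : is_operator mu B).
Hypothesis adjAB : forall f Af g Bg, A (f, Af) -> B (g, Bg) ->
  inner mu Af g = inner mu f Bg.

(** The coefficients of [A] and [B] in K are conjugate, and adjunction exchanges [A] with [B]: each
    summand on the left becomes the other summand on the right. *)
Lemma inner_K f Kf g Kg : K_op A B (f, Kf) -> K_op A B (g, Kg) ->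
  inner mu Kf g = inner mu f Kg.
Proof.
move=> /K_opP[a [b [Afa Bfb ->]]] /K_opP[a' [b' [Aga Bgb ->]]].
have hf := op_L2C_l opA Afa; have ha := op_L2C_r opA Afa; have hb := op_L2C_r opB Bfb.
have hg := op_L2C_l opA Aga; have ha' := op_L2C_r opA Aga; have hb' := op_L2C_r opB Bgb.
rewrite innerDl ?innerDr ?innerZl ?innerZr//; try exact: L2CZ.
rewrite (adjAB Afa Bgb) conjCK.
have -> : inner mu b g = inner mu f a'.
  by rewrite inner_conj// -(adjAB Aga Bfb) -inner_conj.
by rewrite addrC.
Qed.

(** With z = <f, A f>, adjointness gives <f, B f> = z^*, hence <f, K f> = 2 Re ([K_coef] z) = - Re z
    + Im z. The given value [a] may differ on a null set from the one used inside [K_op], which the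
    inner product does not see. *)
Lemma Re_inner_K f Kf a : K_op A B (f, Kf) -> A (f, a) ->
  complex.Re (inner mu f Kf) = - complex.Re (inner mu f a) + complex.Im (inner mu f a).
Proof.
move=> /K_opP[a' [b [Afa' Bfb ->]]] Afa.
have hf := op_L2C_l opA Afa; have ha := op_L2C_r opA Afa.
have ha' := op_L2C_r opA Afa'; have hb := op_L2C_r opB Bfb.
have -> : inner mu f a = inner mu f a'.
  apply: inner_ae; [exact: (L2C_cmeas hf)|exact: (L2C_cmeas hf)|exact: (L2C_cmeas ha)|
    exact: (L2C_cmeas ha')|exact: ae_refl|exact: op_uniq Afa Afa' (ae_refl _ _)].
rewrite innerDr ?innerZr//; try exact: L2CZ.
have -> : inner mu f b = (inner mu f a')^* by rewrite -(adjAB Afa' Bfb) -inner_conj.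
by case: (inner mu f a') => x y /=; field.
Qed.

End adjoint_pair.

End operators.

(** * Operators on real functions and their complexification *)

Section complexification.
Context {R : realType} {d : measure_display} {T : measurableType d}.
Variable mu : {measure set T -> \bar R}.
Implicit Types (A : set ((T -> R) * (T -> R))).

Definition is_real_operator A : Prop :=
  [/\ forall f g, A (f, g) -> f \in Lfun mu 2%:E /\ g \in Lfun mu 2%:E,
      forall f g f' g', A (f, g) -> f' \in Lfun mu 2%:E -> g' \in Lfun mu 2%:E ->
        f' = f %[ae mu] -> g' = g %[ae mu] -> A (f', g'),
      A (fun=> 0, fun=> 0),
      forall (a : R) f1 g1 f2 g2, A (f1, g1) -> A (f2, g2) ->
        A (fun x => a * f1 x + f2 x, fun x => a * g1 x + g2 x) &
      forall f g1 g2, A (f, g1) -> A (f, g2) -> g1 = g2 %[ae mu]].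

(** A complex combination a f1 + f2 is, in its real and in its imaginary part, two nested real
    combinations. *)
Lemma is_operator_complexify A : is_real_operator A -> is_operator mu (complexify A).
Proof.
move=> [hL hae h0 hlin hfun]; split.
- by move=> f g [/= /hL[fr gr] /hL[fi gi]].
- move=> [f g] [/= [fr fi] [gr gi] [f' [g' [[/= Ar Ai] e1 e2]]]]; split => /=.
  + by apply: hae Ar _ _ _ _ => //; [apply: filterS e1|apply: filterS e2] => x /[apply] ->.
  + by apply: hae Ai _ _ _ _ => //; [apply: filterS e1|apply: filterS e2] => x /[apply] ->.
- by split.
- move=> a f1 g1 f2 g2 [/= r1 i1] [/= r2 i2].
  have rD (u v w x : T -> R) b : A (u, v) -> A (w, x) ->
    A (fun t => b * u t + w t, fun t => b * v t + x t) by exact: hlin.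
  split => /=.
  + have := rD _ _ _ _ (complex.Re a) r1 (rD _ _ _ _ (- complex.Im a) i1 r2).
    by congr (A (_, _)); apply/funext => x /=; rewrite raddfD/= Re_mulc; ring.
  + have := rD _ _ _ _ (complex.Re a) i1 (rD _ _ _ _ (complex.Im a) r1 i2).
    by congr (A (_, _)); apply/funext => x /=; rewrite raddfD/= Im_mulc; ring.
- move=> f g1 g2 [/= r1 i1] [/= r2 i2].
  apply: filterS2 (hfun _ _ _ r1 r2) (hfun _ _ _ i1 i2) => x + + Dx => /(_ Dx) e1 /(_ Dx) e2.
  exact: complex_ext.
Qed.

Lemma complexify_adjoint A B : is_real_operator A -> is_real_operator B ->
  (forall f Af g Bg, A (f, Af) -> B (g, Bg) ->
    \int[mu]_x (Af x * g x) = \int[mu]_x (f x * Bg x)) ->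
  forall f Af g Bg, complexify A (f, Af) -> complexify B (g, Bg) ->
    inner mu Af g = inner mu f Bg.
Proof.
move=> [hA _ _ _ _] [hB _ _ _ _] adj f Af g Bg [/= Ar Ai] [/= Br Bi].
have [f1 f2] := hA _ _ Ar; have [f3 f4] := hA _ _ Ai.
have [g1 g2] := hB _ _ Br; have [g3 g4] := hB _ _ Bi.
have iM u v : u \in Lfun mu 2%:E -> v \in Lfun mu 2%:E ->
  mu.-integrable setT (EFin \o (fun x => u x * v x)) by exact: Lfun2_integrableM.
rewrite /inner /cintegral; congr Complex.
- under eq_Rintegral do rewrite Re_mulc Re_conjc Im_conjc mulNr opprK.
  under [RHS]eq_Rintegral do rewrite Re_mulc Re_conjc Im_conjc mulNr opprK.
  by rewrite !RintegralD ?(adj _ _ _ _ Ar Br) ?(adj _ _ _ _ Ai Bi)//; exact: iM.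
- under eq_Rintegral do rewrite Im_mulc Re_conjc Im_conjc mulNr.
  under [RHS]eq_Rintegral do rewrite Im_mulc Re_conjc Im_conjc mulNr.
  by rewrite !RintegralB ?(adj _ _ _ _ Ar Bi) ?(adj _ _ _ _ Ai Br)//; exact: iM.
Qed.

(** Real and imaginary parts are approximated separately, each within e / 2, by elements common to
    both real domains. *)
Lemma dense_complexify (A B : set ((T -> R) * (T -> R))) :
  (forall f g, A (f, g) -> f \in Lfun mu 2%:E) ->
  dense_in_L2 mu ([set f | exists g, A (f, g)] `&` [set f | exists g, B (f, g)]) ->
  dense_in_L2C mu (dom (K_op (complexify A) (complexify B))).
Proof.
move=> AL2 dAB f [fr fi] e e0.
have e20 : 0 < e / 2 by rewrite divr_gt0.
have [hr [[ar Ar] [br Br]] er] := dAB _ fr _ e20.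
have [hi [[ai Ai] [bi Bi]] ei] := dAB _ fi _ e20.
have mhr := Lfun2_measurable (AL2 _ _ Ar).
have mhi := Lfun2_measurable (AL2 _ _ Ai).
exists (fun x => hr x +i* hi x).
  by eexists; exists (fun x => ar x +i* ai x), (fun x => br x +i* bi x); split.
apply: le_lt_trans (norm2_le_ReIm _ _) _.
  have [] : cmeas (fun x => f x - (hr x +i* hi x)).
    have [mfr mfi] : cmeas f by apply: (@L2C_cmeas _ _ _ mu).
    split; first by under eq_fun do rewrite raddfB/=; exact: measurable_funB.
    by under eq_fun do rewrite raddfB/=; exact: measurable_funB.
  by [].
have := lteD er ei; rewrite -EFinD -splitr; apply: le_lt_trans.
rewrite le_eqVlt; apply/orP; left; apply/eqP; congr (_ + _)%E; congr Lnorm;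
  by apply/funext => x; rewrite raddfB.
Qed.

End complexification.

(** * Transition kernels and generators *)

Section integral_comp.
Local Open Scope ereal_scope.
Context {R : realType} {d1 d2 : measure_display}
  {W : measurableType d1} {T : measurableType d2}.
Variables (P : {measure set W -> \bar R}).
Import HBNNSimple.

(** The restriction to [D] has density \1_D. It turns an integral over an event into a full
    integral, to which the mixture identity applies. *)
Lemma ge0_integral_mrestr (D : set W) (mD : measurable D) (f : W -> \bar R) :
  measurable_fun setT f -> (forall w, 0 <= f w) ->
  \int[mrestr P mD]_w f w = \int[P]_(w in D) f w.
Proof.
move=> mf f0.
rewrite (@ge0_integral_density _ _ _ P (mrestr P mD) \1_D)//; last first.
  move=> B mB; rewrite /= /mrestr integral_indic// setIC//.
by rewrite [RHS]integral_mkcond epatch_indic.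
Qed.

Variables (Y : W -> T) (F G : W -> \bar R).
Hypotheses (mY : measurable_fun setT Y).
Hypotheses (mF : measurable_fun setT F) (F0 : forall w, 0 <= F w).
Hypotheses (mG : measurable_fun setT G) (G0 : forall w, 0 <= G w).
Hypothesis FG : forall A, measurable A ->
  \int[P]_(w in Y @^-1` A) F w = \int[P]_(w in Y @^-1` A) G w.

Let measurable_preimage A : measurable A -> measurable (Y @^-1` A).
Proof. by move=> mA; rewrite -[X in measurable X]setTI; exact: mY. Qed.

Let integral_nnsfun_comp (H : W -> \bar R) (g : {nnsfun T >-> R}) :
  measurable_fun setT H -> (forall w, 0 <= H w) ->
  \int[P]_w ((g (Y w))%:E * H w) =
  \sum_(r \in range g) r%:E * \int[P]_(w in Y @^-1` (g @^-1` [set r])) H w.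
Proof.
move=> mH H0.
have termE r w : r%:E * (H \_ (Y @^-1` (g @^-1` [set r]))) w =
    (r * \1_(g @^-1` [set r]) (Y w))%:E * H w.
  by rewrite epatch_indic EFinM -muleA; congr (_ * _); rewrite muleC.
have term_ge0 r w : 0 <= r%:E * (H \_ (Y @^-1` (g @^-1` [set r]))) w.
  by rewrite termE mule_ge0// nnfun_muleindic_ge0.
transitivity (\int[P]_w \sum_(r \in range g) r%:E * (H \_ (Y @^-1` (g @^-1` [set r]))) w).
  apply: eq_integral => w _; under eq_fsbigr do rewrite termE.
  rewrite -ge0_mule_fsuml; last by move=> r; rewrite nnfun_muleindic_ge0.
  by rewrite [in LHS]fimfunE -fsumEFin.
have mHr r : measurable_fun setT (H \_ (Y @^-1` (g @^-1` [set r]))).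
  apply/(measurable_restrictT _ _).1 => //; first exact: measurable_preimage.
  exact: measurable_funTS.
rewrite ge0_integral_fsum//; last by move=> r; exact: measurable_funeM.
apply: eq_fsbigr => r _; rewrite [in RHS]integral_mkcond.
have [r0|r0] := leP 0%R r.
  by rewrite ge0_integralZl// => w _; rewrite patchE; case: ifP.
rewrite preimage_nnfun0// preimage_set0.
under [LHS]eq_integral do rewrite epatch_indic indic0 mule0 mule0.
under [X in _ = _ * X]eq_integral do rewrite epatch_indic indic0 mule0.
by rewrite integral0 mule0.
Qed.

(** The defining property of a conditional expectation given [Y], extended from events Y^-1(A) to
    nonnegative weights v(Y) by simple approximation and monotone convergence. *)
Lemma ge0_integral_comp_eq (v : T -> R) :
  measurable_fun setT v -> (forall x, (0 <= v x)%R) ->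
  \int[P]_w ((v (Y w))%:E * F w) = \int[P]_w ((v (Y w))%:E * G w).
Proof.
move=> mv v0; have mv' : measurable_fun setT (EFin \o v) by exact/measurable_EFinP.
pose g := nnsfun_approx measurableT mv'.
have lim_g (H : W -> \bar R) : measurable_fun setT H -> (forall w, 0 <= H w) ->
    \int[P]_w ((g n (Y w))%:E * H w) @[n --> \oo] --> \int[P]_w ((v (Y w))%:E * H w).
  move=> mH H0.
  rewrite (_ : integral P _ _ = \int[P]_w limn (fun n => (g n (Y w))%:E * H w)); last first.
    apply: eq_integral => w _; apply/esym/cvg_lim => //.
    have lim_g : (g n (Y w))%:E @[n --> \oo] --> (v (Y w))%:E.
      by apply: cvg_nnsfun_approx => // x _; rewrite lee_fin.
    (* Where H is infinite the product is continuous only away from 0 * oo. If v(Y w) = 0, the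
       approximations, lying between 0 and [v], vanish too, and all products are 0. *)
    have [Hfin|Hfin] := boolP (H w \is a fin_num); first exact: cvgeZr.
    have [vw0|vw0] := eqVneq (v (Y w)) 0%R; last first.
      by apply: cvgeM lim_g (cvg_cst _); exact: mule_def_neq0_infty.
    rewrite vw0 mul0e (_ : (fun n => _) = fun=> 0); first exact: cvg_cst.
    apply/funext => n; rewrite (_ : g n (Y w) = 0%R) ?mul0e//.
    apply/eqP; rewrite eq_le; apply/andP; split => //.
    by rewrite -lee_fin -vw0 /g nnsfun_approxE le_approx// => x _; rewrite lee_fin.
  apply: cvg_monotone_convergence => //.
  - move=> n; apply: emeasurable_funM => //; apply/measurable_EFinP.
    exact: measurableT_comp.
  - by move=> n w _; rewrite mule_ge0// lee_fin.
  - move=> w _ a b ab; rewrite lee_wpmul2r// lee_fin; exact/lefP/nd_nnsfun_approx.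
have lim_F := lim_g _ mF F0.
suff lim_G : \int[P]_w ((g n (Y w))%:E * F w) @[n --> \oo] -->
    \int[P]_w ((v (Y w))%:E * G w) by exact: cvg_unique lim_F lim_G.
rewrite (_ : (fun n => _) = fun n => \int[P]_w ((g n (Y w))%:E * G w)); last first.
  apply/funext => n; rewrite !integral_nnsfun_comp//.
  by apply: eq_fsbigr => r _; rewrite FG.
exact: lim_g.
Qed.

End integral_comp.

Section probability_kernel.
Context {R : realType} {d : measure_display} {T : measurableType d}.
Variables (mu : {measure set T -> \bar R}) (k : R.-pker T ~> T).

Local Notation km x := (k x : {measure set T -> \bar R}).

Lemma measurable_kernel_integral (f : T -> \bar R) :
  measurable_fun setT f -> (forall x, 0 <= f x)%E ->
  measurable_fun setT (fun x => \int[k x]_y f y)%E.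
Proof.
move=> mf f0; apply: (@measurable_fun_integral_kernel _ _ _ _ _ (fun x => km x)) => //.
by move=> B mB; exact: measurable_kernel.
Qed.

Lemma measurable_kernel_Rintegral (f : T -> R) : measurable_fun setT f ->
  measurable_fun setT (fun x => \int[k x]_y f y).
Proof.
move=> mf; have mf' : measurable_fun setT (EFin \o f) by exact/measurable_EFinP.
rewrite (_ : (fun x => \int[k x]_y f y) = fine \o
    (fun x => \int[k x]_y ((EFin \o f)^\+ y) - \int[k x]_y ((EFin \o f)^\- y))%E); last first.
  by apply/funext => x; rewrite /Rintegral integralE.
apply: measurableT_comp => //; apply: emeasurable_funB; apply: measurable_kernel_integral => //.
- exact: measurable_funepos.
- exact: measurable_funeneg.
Qed.

Hypothesis inv : forall B, measurable B -> (mu B = \int[mu]_x k x B)%E.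

Lemma ge0_integral_invariant (f : T -> \bar R) :
  measurable_fun setT f -> (forall x, 0 <= f x)%E ->
  (\int[mu]_x f x = \int[mu]_x \int[k x]_y f y)%E.
Proof.
move=> mf f0; apply: (@ge0_integral_mixture _ _ _ _ _ mu (fun x => km x)) => //.
by move=> B mB; exact: measurable_kernel.
Qed.

(** By invariance the integral of f^2 against [mu] is that of x |-> \int f^2 d(k x), which is
    therefore finite almost everywhere; [k x] being a probability, L^2(k x) is contained in L^1(k
    x). *)
Lemma ae_integrable_kernel (f : T -> R) : f \in Lfun mu 2%:E ->
  \forall x \ae mu, (km x).-integrable setT (EFin \o f).
Proof.
move=> /Lfun2P[mf fin].
have mf2 : measurable_fun setT (fun y => (f y ^+ 2)%:E).
  by apply/measurable_EFinP; exact: measurable_funX.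
have f20 y : (0 <= (f y ^+ 2)%:E)%E by rewrite lee_fin sqr_ge0.
have int_kf2 : mu.-integrable setT (fun x => \int[k x]_y (f y ^+ 2)%:E)%E.
  apply/integrableP; split; first exact: measurable_kernel_integral.
  under eq_integral do rewrite gee0_abs ?integral_ge0//.
  by rewrite -ge0_integral_invariant.
apply: filterS (integrable_ae measurableT int_kf2) => x /(_ I) kf2x.
apply/Lfun1_integrable/Lfun_subset12; last first.
  by apply/Lfun2P; split => //; rewrite -ge0_fin_numE// integral_ge0.
by rewrite prob_kernel.
Qed.

End probability_kernel.

Section semigroup.
Context {R : realType} {d : measure_display} {T : measurableType d}.
Variables (mu : {measure set T -> \bar R}) (p : transition_function R T).
Hypothesis inv : forall (t : R) (B : set T), 0 < t -> measurable B ->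
  (mu B = \int[mu]_x p t x B)%E.

Lemma measurable_semigroup (t : R) (f : T -> R) : measurable_fun setT f ->
  measurable_fun setT (semigroup p t f).
Proof. exact: measurable_kernel_Rintegral. Qed.

(** Only almost everywhere: linearity of the real-valued integral is available at the points x where
    both functions are integrable against p_t(x, .). *)
Lemma ae_semigroup_lin (t a : R) (f g : T -> R) : 0 < t ->
  f \in Lfun mu 2%:E -> g \in Lfun mu 2%:E ->
  semigroup p t (fun x => a * f x + g x) =
  (fun x => a * semigroup p t f x + semigroup p t g x) %[ae mu].
Proof.
move=> t0 hf hg; have inv_t B : measurable B -> (mu B = \int[mu]_x p t x B)%E by exact: inv.
apply: filterS2 (ae_integrable_kernel inv_t hf) (ae_integrable_kernel inv_t hg).
move=> x fi gi _; rewrite /semigroup RintegralD//; last exact: (integrableZl measurableT a fi).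
by rewrite RintegralZl.
Qed.

(** The semigroup is well defined on classes: if N is [mu]-null, invariance makes it null for p_t(x,
    .) at almost every x. *)
Lemma ae_semigroup (t : R) (f g : T -> R) : 0 < t ->
  measurable_fun setT f -> measurable_fun setT g ->
  f = g %[ae mu] -> semigroup p t f = semigroup p t g %[ae mu].
Proof.
move=> t0 mf mg [N [mN N0 hN]].
have mpN : measurable_fun setT (fun x => p t x N) by exact: measurable_kernel.
have /(ae_eq_integral_abs _ measurableT mpN) : (\int[mu]_x `|p t x N| = 0)%E.
  by under eq_integral do rewrite gee0_abs//; rewrite -(inv t0 mN).
apply: filterS => x /(_ I) pN0 _; rewrite /semigroup /Rintegral; congr fine.
apply: ae_eq_integral => //; try exact/measurable_EFinP.
exists N; split => // y /= nfg; apply: hN => /= fg; apply: nfg => _.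
by rewrite fg.
Qed.

Lemma semigroup_cst (t c : R) : semigroup p t (fun=> c) = fun=> c.
Proof.
apply/funext => x; rewrite /semigroup Rintegral_cst// prob_kernel mulr1//.
Qed.

Let quotient_err t (F : (T -> R) * (T -> R)) : \bar R :=
  ('N[mu]_2%:E[(fun x => (t^-1 * (semigroup p t F.1 x - F.1 x) - F.2 x)%:E)])%E.

Let measurable_quotient t (f g : T -> R) : measurable_fun setT f -> measurable_fun setT g ->
  measurable_fun setT (fun x => t^-1 * (semigroup p t f x - f x) - g x).
Proof.
move=> mf mg; apply: measurable_funB => //; apply: measurable_funM => //.
by apply: measurable_funB => //; exact: measurable_semigroup.
Qed.

(** One triangle inequality for two purposes: it gives linearity of the generator and, with a = -1
    and f1 = f2, uniqueness of its value. *)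
Let quotient_err_lin t a f1 g1 f2 g2 : 0 < t ->
  f1 \in Lfun mu 2%:E -> g1 \in Lfun mu 2%:E -> f2 \in Lfun mu 2%:E -> g2 \in Lfun mu 2%:E ->
  (quotient_err t (fun x => a * f1 x + f2 x, fun x => a * g1 x + g2 x)%R <=
   `|a|%:E * quotient_err t (f1, g1) + quotient_err t (f2, g2))%E.
Proof.
move=> t0 hf1 hg1 hf2 hg2.
have mf1 := Lfun2_measurable hf1; have mg1 := Lfun2_measurable hg1.
have mf2 := Lfun2_measurable hf2; have mg2 := Lfun2_measurable hg2.
have mq1 := measurable_quotient t mf1 mg1; have mq2 := measurable_quotient t mf2 mg2.
rewrite /quotient_err /= -Lnorm2Z//.
have maq1 : measurable_fun setT
    (fun x => a * (t^-1 * (semigroup p t f1 x - f1 x) - g1 x)) by exact: measurable_funM.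
apply: le_trans (minkowski_EFin mu maq1 mq2 (ler1n R 2)).
rewrite le_eqVlt; apply/orP; left; apply/eqP; apply: Lnorm_eq_ae.
- by apply: measurable_quotient; apply: measurable_funD => //; exact: measurable_funM.
- exact: measurable_funD.
- apply: filterS (ae_semigroup_lin a t0 hf1 hf2) => x /[apply] -> /=; ring.
Qed.

Lemma is_real_operator_generator : is_real_operator mu (generator mu p).
Proof.
split.
- by move=> f g [].
- move=> f g f' g' [/= hf hg lim0] hf' hg' ff' gg'; split => //=.
  have mf := Lfun2_measurable hf; have mg := Lfun2_measurable hg.
  have mf' := Lfun2_measurable hf'; have mg' := Lfun2_measurable hg'.
  apply: cvg_trans lim0; apply: near_eq_cvg; near=> t.
  have t0 : 0 < t by near: t; exact: nbhs_right_gt.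
  apply: Lnorm_eq_ae; [exact: measurable_quotient|exact: measurable_quotient|].
  have := ae_semigroup t0 mf' mf ff'.
  move: ff' gg'; apply: filterS3 => x e1 e2 e3 Dx.
  by rewrite e1// e2// e3.
- split => /=; [exact: Lfun2_cst0..|].
  rewrite (_ : (fun _ => _) = fun=> 0%E); first exact: cvg_cst.
  apply/funext => t; rewrite -[RHS](@Lnorm0 _ _ _ mu 2%:E)//; congr Lnorm.
  by apply/funext => x; rewrite semigroup_cst !subr0 mulr0.
- move=> a f1 g1 f2 g2 [/= hf1 hg1 lim1] [/= hf2 hg2 lim2]; split => /=.
  + by apply: Lfun2D => //; exact: Lfun2Z.
  + by apply: Lfun2D => //; exact: Lfun2Z.
  have lim12 : (`|a|%:E * quotient_err t (f1, g1) + quotient_err t (f2, g2) @[t --> 0^'+]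
      --> `|a|%:E * 0 + 0)%E.
    by apply: cvgeD lim2; [rewrite mule0|exact: cvgeZl].
  rewrite mule0 adde0 in lim12.
  apply: (squeeze_cvge _ (cvg_cst 0%E) lim12); near=> t.
  have t0 : 0 < t by near: t; exact: nbhs_right_gt.
  by rewrite Lnorm_ge0/=; exact: quotient_err_lin.
- move=> f g1 g2 [/= hf hg1 lim1] [/= _ hg2 lim2].
  have mg1 := Lfun2_measurable hg1; have mg2 := Lfun2_measurable hg2.
  apply: (@LnormB_eq0 _ _ _ mu) => //.
  have lim12 : (`|-1|%:E * quotient_err t (f, g1) + quotient_err t (f, g2) @[t --> 0^'+]
      --> `|-1|%:E * 0 + 0)%E.
    by apply: cvgeD lim2; [rewrite mule0|exact: cvgeZl].
  rewrite mule0 adde0 in lim12.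
  apply/eqP; rewrite eq_le Lnorm_ge0 andbT; apply: cvge_ge lim12; near=> t.
  have t0 : 0 < t by near: t; exact: nbhs_right_gt.
  (* The difference quotient of - f + f vanishes, so what remains of the error is the norm of g1 -
     g2, independent of t. *)
  apply: le_trans (quotient_err_lin (-1) t0 hf hg1 hf hg2).
  rewrite le_eqVlt; apply/orP; left; apply/eqP; rewrite /quotient_err; congr Lnorm.
  apply/funext => x /=; rewrite (_ : (fun _ => _) = fun=> 0); last first.
    by apply/funext => y; rewrite mulN1r addNr.
  by rewrite semigroup_cst; congr EFin; ring.
Unshelve. all: by end_near. Qed.

Lemma generator_cst (c : R) : (mu setT < +oo)%E -> generator mu p (fun=> c, fun=> 0).
Proof.
move=> mufin; split => /=.
- apply/Lfun2P; split => //; rewrite integral_cst//.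
  by rewrite lte_mul_pinfty// lee_fin sqr_ge0.
- exact: Lfun2_cst0.
- rewrite (_ : (fun _ => _) = fun=> 0%E); first exact: cvg_cst.
  apply/funext => t; rewrite -[RHS](@Lnorm0 _ _ _ mu 2%:E)//; congr Lnorm.
  by apply/funext => x; rewrite semigroup_cst subrr subr0 mulr0.
Qed.

End semigroup.

(** * Joint laws at two times and duality of the generators *)

Section transition.
Context {R : realType} {d1 d2 : measure_display}
  {W : measurableType d1} {T : measurableType d2}.
Variables (P : {measure set W -> \bar R}) (mu : {measure set T -> \bar R}).
Variables (Y0 Y1 : W -> T) (k : R.-pker T ~> T).
Hypotheses (mY0 : measurable_fun setT Y0) (mY1 : measurable_fun setT Y1).
Hypothesis Y0mu : forall B, measurable B -> P (Y0 @^-1` B) = mu B.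
Hypothesis Y1mu : forall B, measurable B -> P (Y1 @^-1` B) = mu B.
Hypothesis trans : forall A B, measurable A -> measurable B ->
  P (Y0 @^-1` A `&` Y1 @^-1` B) = (\int[P]_(w in Y0 @^-1` A) k (Y0 w) B)%E.

Local Notation km x := (k x : {measure set T -> \bar R}).

Lemma ge0_integral_marginal (Y : W -> T) (f : T -> \bar R) : measurable_fun setT Y ->
  (forall B, measurable B -> P (Y @^-1` B) = mu B) ->
  measurable_fun setT f -> (forall x, 0 <= f x)%E ->
  (\int[P]_w f (Y w) = \int[mu]_x f x)%E.
Proof.
move=> mY Ymu mf f0; rewrite -[LHS](ge0_integral_pushforward mY P measurableT mf)//.
by apply: eq_measure_integral => B mB _; exact: Ymu.
Qed.

(** [k (Y0 w)] is the conditional law of [Y1] given [Y0]. On an event Y0^-1(A), the image under [Y1]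
    of the restricted measure is a mixture of these laws, which handles [u]; passing from the events
    to the weight v(Y0) handles [v]. *)
Lemma ge0_integral_transition (u v : T -> R) :
  measurable_fun setT u -> measurable_fun setT v ->
  (forall x, 0 <= u x) -> (forall x, 0 <= v x) ->
  (\int[P]_w (v (Y0 w) * u (Y1 w))%:E = \int[mu]_x ((v x)%:E * \int[k x]_y (u y)%:E))%E.
Proof.
move=> mu_ mv u0 v0.
have mu' : measurable_fun setT (EFin \o u) by exact/measurable_EFinP.
have u0' x : (0 <= (EFin \o u) x)%E by rewrite lee_fin.
have mKu := measurable_kernel_integral k mu' u0'.
have Ku0 x : (0 <= \int[k x]_y (EFin \o u) y)%E by exact: integral_ge0.
under eq_integral do rewrite EFinM.
have mKuY : measurable_fun setT (fun w => \int[k (Y0 w)]_y (EFin \o u) y)%E.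
  exact: measurableT_comp mKu mY0.
have muY : measurable_fun setT (fun w => (u (Y1 w))%:E).
  by apply/measurable_EFinP; exact: measurableT_comp.
have eq_on A : measurable A -> (\int[P]_(w in Y0 @^-1` A) (u (Y1 w))%:E =
    \int[P]_(w in Y0 @^-1` A) \int[k (Y0 w)]_y (EFin \o u) y)%E.
  move=> mA; have mD : measurable (Y0 @^-1` A).
    by rewrite -[X in measurable X]setTI; exact: mY0.
  have mkY0 B : measurable B -> measurable_fun [set: W] (fun w => km (Y0 w) B).
    move=> mB; apply: (measurableT_comp (f := fun x => km x B)) => //.
    exact: measurable_kernel.
  rewrite -(ge0_integral_mrestr P mD)//; last by move=> w; rewrite lee_fin.
  rewrite -(ge0_integral_mrestr P mD)//.
  pose m := measure_function_pushforward__canonical__measure_function_Measure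
    (mrestr P mD) mY1.
  rewrite -[LHS](ge0_integral_pushforward mY1 (mrestr P mD) measurableT mu')//.
  apply: (@ge0_integral_mixture _ _ _ _ _ (mrestr P mD) (fun w => km (Y0 w)) m) => //.
  move=> B mB; rewrite /m/= /pushforward /mrestr/= setIC trans//.
  by rewrite -(ge0_integral_mrestr P mD)//; exact: mkY0.
have uY0 w : (0 <= (u (Y1 w))%:E)%E by rewrite lee_fin.
rewrite (ge0_integral_comp_eq mY0 muY uY0 mKuY _ eq_on mv v0)//.
apply: (@ge0_integral_marginal Y0 (fun x => (v x)%:E * \int[k x]_y (EFin \o u) y)%E) => //.
- by apply: emeasurable_funM => //; exact/measurable_EFinP.
- by move=> x; rewrite mule_ge0// lee_fin.
Qed.

Local Notation S f := (fun x => \int[k x]_y f y).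

Lemma Lfun2_marginal (Y : W -> T) (f : T -> R) : measurable_fun setT Y ->
  (forall B, measurable B -> P (Y @^-1` B) = mu B) ->
  f \in Lfun mu 2%:E -> (f \o Y) \in Lfun P 2%:E.
Proof.
move=> mY Ymu /Lfun2P[mf fin]; apply/Lfun2P; split; first exact: measurableT_comp.
rewrite (@ge0_integral_marginal Y (fun x => (f x ^+ 2)%:E))//.
- by apply/measurable_EFinP; exact: measurable_funX.
- by move=> x; rewrite lee_fin sqr_ge0.
Qed.

Lemma Lfun2_norm (f : T -> R) : f \in Lfun mu 2%:E -> (fun x => `|f x|) \in Lfun mu 2%:E.
Proof.
move=> /Lfun2P[mf fin]; apply/Lfun2P; split; first exact: measurableT_comp.
by under eq_integral do rewrite real_normK ?num_real//.
Qed.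

(** |S f| |g| is dominated by |g| S|f|, whose integral is that of |g(Y0)| |f(Y1)| over the process.
    This is finite because both factors are in L^2(P), their marginal being [mu]. *)
Lemma integrable_SM (f g : T -> R) : f \in Lfun mu 2%:E -> g \in Lfun mu 2%:E ->
  mu.-integrable setT (fun x => (S f x * g x)%:E).
Proof.
move=> hf hg; have mf := Lfun2_measurable hf; have mg := Lfun2_measurable hg.
have mSf := measurable_kernel_Rintegral k mf.
have maf : measurable_fun setT (fun x => `|f x|) by exact: measurableT_comp.
have mag : measurable_fun setT (fun x => `|g x|) by exact: measurableT_comp.
apply/integrableP; split; first by apply/measurable_EFinP; exact: measurable_funM.
apply: (@le_lt_trans _ _ (\int[mu]_x ((`|g x|)%:E * \int[k x]_y (`|f y|)%:E))%E).
  apply: ge0_le_integral => //.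
  - by apply/measurable_EFinP; apply: measurableT_comp => //; exact: measurable_funM.
  - apply: emeasurable_funM; first exact/measurable_EFinP.
    by apply: measurable_kernel_integral => [|x]; [exact/measurable_EFinP|rewrite lee_fin].
  - move=> x _; rewrite /= normrM EFinM muleC lee_wpmul2l ?lee_fin//.
    have [Ifin|] := boolP (\int[k x]_y (f y)%:E \is a fin_num)%E.
      rewrite /Rintegral -abse_EFin fineK//.
      by apply: le_abse_integral => //; exact/measurable_EFinP.
    (* [fine] sends an infinite integral to 0, so the bound holds at these points as well. *)
    move=> Ifin; have -> : \int[k x]_y f y = 0.
      by rewrite /Rintegral; move: Ifin; case: (\int[k x]_y (f y)%:E)%E.
    by rewrite normr0; apply: integral_ge0 => y _; rewrite lee_fin.
rewrite -ge0_integral_transition//.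
have := Lfun2_integrableM (Lfun2_marginal mY0 Y0mu (Lfun2_norm hg))
  (Lfun2_marginal mY1 Y1mu (Lfun2_norm hf)).
by move=> /integrableP[_]; under eq_integral do rewrite gee0_abs ?lee_fin ?mulr_ge0//=.
Qed.

Let inv B : measurable B -> (mu B = \int[mu]_x k x B)%E.
Proof.
move=> mB; rewrite -Y1mu// -[Y1 @^-1` B]setTI -(preimage_setT Y0) trans// preimage_setT.
by apply: (@ge0_integral_marginal Y0 (fun x => km x B)) => //; exact: measurable_kernel.
Qed.

Let transition_ge0 (f g : T -> R) : f \in Lfun mu 2%:E -> g \in Lfun mu 2%:E ->
  (forall x, 0 <= f x) -> (forall x, 0 <= g x) ->
  \int[P]_w (g (Y0 w) * f (Y1 w)) = \int[mu]_x (g x * S f x).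
Proof.
move=> hf hg f0 g0; have mf := Lfun2_measurable hf; have mg := Lfun2_measurable hg.
rewrite /Rintegral ge0_integral_transition//; congr fine; apply: ae_eq_integral => //.
- apply: emeasurable_funM; first exact/measurable_EFinP.
  by apply: measurable_kernel_integral => [|x]; [exact/measurable_EFinP|rewrite lee_fin].
- by apply/measurable_EFinP; apply: measurable_funM => //; exact: measurable_kernel_Rintegral.
- apply: filterS (ae_integrable_kernel inv hf) => x fi _.
  by rewrite EFinM /Rintegral fineK//; exact: integrable_fin_num fi.
Qed.

Lemma Rintegral_transition (f g : T -> R) : f \in Lfun mu 2%:E -> g \in Lfun mu 2%:E ->
  \int[P]_w (g (Y0 w) * f (Y1 w)) = \int[mu]_x (g x * S f x).
Proof.
move=> hf hg.
(* The parts (|h| + h) / 2 and (|h| - h) / 2 are combinations of L^2 functions. Bilinearity reduces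
   the claim to four pairs of nonnegative functions. *)
have pos (h : T -> R) : h \in Lfun mu 2%:E -> exists h1 h2 : T -> R,
    [/\ h1 \in Lfun mu 2%:E, h2 \in Lfun mu 2%:E, forall x, 0 <= h1 x,
      forall x, 0 <= h2 x & h = fun x => h1 x - h2 x].
  move=> hh; exists (fun x => 2^-1 * `|h x| + 2^-1 * h x),
    (fun x => 2^-1 * `|h x| + - 2^-1 * h x); split.
  - by apply: Lfun2_lin => //; exact: Lfun2_norm.
  - by apply: Lfun2_lin => //; exact: Lfun2_norm.
  - by move=> x; have := ler_norm (- h x); rewrite normrN; lra.
  - by move=> x; have := ler_norm (h x); lra.
  - by apply/funext => x; field.
have [f1 [f2 [hf1 hf2 f10 f20 ->]]] := pos _ hf.
have [g1 [g2 [hg1 hg2 g10 g20 ->]]] := pos _ hg.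
have iW u v : u \in Lfun mu 2%:E -> v \in Lfun mu 2%:E ->
    P.-integrable setT (EFin \o (fun w => v (Y0 w) * u (Y1 w))).
  move=> hu hv; exact: (Lfun2_integrableM (Lfun2_marginal mY0 Y0mu hv)
    (Lfun2_marginal mY1 Y1mu hu)).
have iT u v : u \in Lfun mu 2%:E -> v \in Lfun mu 2%:E ->
    mu.-integrable setT (EFin \o (fun x => v x * S u x)).
  move=> hu hv; rewrite (_ : _ \o _ = fun x => (S u x * v x)%:E); last first.
    by apply/funext => x; rewrite /= mulrC.
  exact: integrable_SM.
have iB d (V : measurableType d) (m : {measure set V -> \bar R}) (u v : V -> R) :
    m.-integrable setT (EFin \o u) -> m.-integrable setT (EFin \o v) ->
    m.-integrable setT (EFin \o (fun x => u x - v x)).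
  by move=> iu iv; exact: integrableB iu iv.
transitivity (\int[P]_w ((g1 (Y0 w) * f1 (Y1 w) - g1 (Y0 w) * f2 (Y1 w)) -
    (g2 (Y0 w) * f1 (Y1 w) - g2 (Y0 w) * f2 (Y1 w)))).
  by apply: eq_Rintegral => w _; ring.
rewrite !RintegralB//; try exact: iW; try by apply: iB; exact: iW.
rewrite !transition_ge0//.
rewrite -!RintegralB//; try exact: iT; try by apply: iB; exact: iT.
have mS := measurable_kernel_Rintegral k; have mL := @Lfun2_measurable _ _ _ mu.
rewrite /Rintegral; congr fine; apply: ae_eq_integral => //.
- apply/measurable_EFinP; apply: measurable_funB; apply: measurable_funB;
    by apply: measurable_funM; [exact: mL|exact/mS/mL].
- apply/measurable_EFinP; apply: measurable_funM.
    by apply: measurable_funB; exact: mL.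
  by apply/mS/measurable_funB; exact: mL.
(* S (f1 - f2) = S f1 - S f2 holds where both parts are integrable against [k x], hence almost
   everywhere. *)
- apply: filterS2 (ae_integrable_kernel inv hf1) (ae_integrable_kernel inv hf2) => x i1 i2 _.
  by have := RintegralB measurableT i1 i2; rewrite /Rintegral => ->; congr EFin; ring.
Qed.

End transition.

Section markov_duality.
Context {R : realType} {dO d : measure_display}
  {Omega : measurableType dO} {T : measurableType d}.
Variables (P : {measure set Omega -> \bar R}) (X : R -> Omega -> T)
  (p q : transition_function R T) (mu : {measure set T -> \bar R}).
Hypotheses (markov : is_markov_process P X p q) (marg : one_time_marginal P X mu).

Let sigma_generated_preimage (I : set R) s A : I s -> measurable A ->
  sigma_generated X I (X s @^-1` A).
Proof.
move=> Is mA; apply: sub_sigma_algebra; exists s => //; exists A => //.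
by rewrite setTI.
Qed.

(* Both sides are the integral of [g (X_0) * f (X_t)] over the process. *)
Lemma semigroup_duality (t : R) (f g : T -> R) : 0 < t ->
  f \in Lfun mu 2%:E -> g \in Lfun mu 2%:E ->
  \int[mu]_x (g x * semigroup p t f x) = \int[mu]_x (f x * semigroup q t g x).
Proof.
move=> t0 hf hg; have [mX fwd bwd] := markov.
have mX_ s : measurable_fun setT (X s) := mX s.
rewrite -(@Rintegral_transition _ _ _ _ _ P mu (X 0) (X (0 + t)) (p t))//; last 3 first.
- exact: marg.
- exact: marg.
- move=> A B mA mB; apply: fwd => //; first exact: ltW.
  by apply: sigma_generated_preimage => //=.
rewrite -(@Rintegral_transition _ _ _ _ _ P mu (X t) (X (t - t)) (q t))//; last 3 first.
- exact: marg.
- exact: marg.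
- move=> A B mA mB; apply: bwd => //; first exact: ltW.
  by apply: sigma_generated_preimage => //=.
by rewrite subrr add0r; apply: eq_Rintegral => w _; rewrite mulrC.
Qed.

Lemma integrable_semigroupM (t : R) (f g : T -> R) : 0 < t ->
  f \in Lfun mu 2%:E -> g \in Lfun mu 2%:E ->
  mu.-integrable setT (fun x => (semigroup p t f x * g x)%:E) /\
  mu.-integrable setT (fun x => (semigroup q t f x * g x)%:E).
Proof.
move=> t0 hf hg; have [mX fwd bwd] := markov; split.
- apply: (@integrable_SM _ _ _ _ _ P mu (X 0) (X (0 + t)) (p t)) => //.
  + exact: marg.
  + exact: marg.
  + move=> A B mA mB; apply: fwd => //; first exact: ltW.
    by apply: sigma_generated_preimage => //=.
- apply: (@integrable_SM _ _ _ _ _ P mu (X t) (X (t - t)) (q t)) => //.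
  + exact: marg.
  + exact: marg.
  + move=> A B mA mB; apply: bwd => //; first exact: ltW.
    by apply: sigma_generated_preimage => //=.
Qed.

(** Cauchy-Schwarz with [a] merely measurable, the right side being possibly infinite: [a] will be
    the error of a difference quotient, and only the integrability of its product with [b] is at
    hand. *)
Let normr_Rintegral_le (a b : T -> R) : measurable_fun setT a -> b \in Lfun mu 2%:E ->
  mu.-integrable setT (fun x => (a x * b x)%:E) ->
  (`|\int[mu]_x (a x * b x)|%:E <= 'N[mu]_2%:E[(fun x => (a x)%:E)] *
     'N[mu]_2%:E[(fun x => (b x)%:E)])%E.
Proof.
move=> ma hb iab; have mb := Lfun2_measurable hb.
apply: le_trans (hoelder mu ma mb _ _ _) => //; last by rewrite [RHS]splitr !div1r.
rewrite Lnorm1 EFin_normr_Rintegral//; apply: le_abse_integral => //.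
by apply/measurable_EFinP; exact: measurable_funM.
Qed.

(** For each t > 0 the semigroup terms cancel by duality, so <Lf, g> - <f, Lg> = <err_g(t), f> -
    <err_f(t), g>, where err is the difference quotient minus the generator. The left side does not
    depend on t, and the right side tends to 0 by Cauchy-Schwarz. *)
Lemma generator_duality (f Lf g Lg : T -> R) :
  generator mu p (f, Lf) -> generator mu q (g, Lg) ->
  \int[mu]_x (Lf x * g x) = \int[mu]_x (f x * Lg x).
Proof.
move=> [/= hf hLf limf] [/= hg hLg limg].
have mf := Lfun2_measurable hf; have mg := Lfun2_measurable hg.
have mLf := Lfun2_measurable hLf; have mLg := Lfun2_measurable hLg.
have Nfin (h : T -> R) : h \in Lfun mu 2%:E ->
    'N[mu]_2%:E[(fun x => (h x)%:E)]%E \is a fin_num.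
  move=> /Lfun2P[_ fin]; rewrite ge0_fin_numE ?Lnorm_ge0//.
  by rewrite Lnorm2E poweR_lty.
pose errf t := 'N[mu]_2%:E[(fun x => (t^-1 * (semigroup p t f x - f x) - Lf x)%:E)]%E.
pose errg t := 'N[mu]_2%:E[(fun x => (t^-1 * (semigroup q t g x - g x) - Lg x)%:E)]%E.
have lim0 : (errf t * 'N[mu]_2%:E[(fun x => (g x)%:E)] +
    errg t * 'N[mu]_2%:E[(fun x => (f x)%:E)] @[t --> 0^'+] -->
    0 * 'N[mu]_2%:E[(fun x => (g x)%:E)] + 0 * 'N[mu]_2%:E[(fun x => (f x)%:E)])%E.
  by apply: cvgeD; [rewrite !mul0e|apply: cvgeZr limf; exact: Nfin|
    apply: cvgeZr limg; exact: Nfin].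
rewrite !mul0e adde0 in lim0.
apply/eqP; rewrite -subr_eq0 -normr_eq0 eq_le normr_ge0 andbT -lee_fin.
apply: cvge_ge lim0; near=> t; have t0 : 0 < t by near: t; exact: nbhs_right_gt.
have tN0 : t != 0 by rewrite gt_eqF.
have [iSfg _] := integrable_semigroupM t0 hf hg.
have [_ iSgf] := integrable_semigroupM t0 hg hf.
have ifg := Lfun2_integrableM hf hg; have igf := Lfun2_integrableM hg hf.
have iLfg := Lfun2_integrableM hLf hg; have iLgf := Lfun2_integrableM hLg hf.
have mSf : measurable_fun setT (semigroup p t f) by exact: measurable_semigroup.
have mSg : measurable_fun setT (semigroup q t g) by exact: measurable_semigroup.
have combo (u v w : T -> R) : mu.-integrable setT (EFin \o u) ->
    mu.-integrable setT (EFin \o v) -> mu.-integrable setT (EFin \o w) ->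
    mu.-integrable setT (EFin \o (fun x => t^-1 * (u x - v x) - w x)) /\
    \int[mu]_x (t^-1 * (u x - v x) - w x) =
    t^-1 * (\int[mu]_x u x - \int[mu]_x v x) - \int[mu]_x w x.
  move=> iu iv iw.
  have iuv : mu.-integrable setT (EFin \o (fun x => u x - v x)).
    by exact: integrableB iu iv.
  have ituv : mu.-integrable setT (EFin \o (fun x => t^-1 * (u x - v x))).
    exact: (integrableZl measurableT (t^-1) iuv).
  split; first exact: integrableB ituv iw.
  by rewrite RintegralB// RintegralZl// RintegralB.
have [iF EF] := combo _ _ _ iSfg ifg iLfg.
have [iG EG] := combo _ _ _ iSgf igf iLgf.
have -> : \int[mu]_x (Lf x * g x) - \int[mu]_x (f x * Lg x) =
    \int[mu]_x ((t^-1 * (semigroup q t g x - g x) - Lg x) * f x) -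
    \int[mu]_x ((t^-1 * (semigroup p t f x - f x) - Lf x) * g x).
  transitivity (\int[mu]_x (t^-1 * (semigroup q t g x * f x - g x * f x) - Lg x * f x) -
    \int[mu]_x (t^-1 * (semigroup p t f x * g x - f x * g x) - Lf x * g x)); last first.
    by congr (_ - _); apply: eq_Rintegral => x _; ring.
  rewrite EF EG.
  have -> : \int[mu]_x (semigroup q t g x * f x) = \int[mu]_x (semigroup p t f x * g x).
    under eq_Rintegral do rewrite mulrC.
    by rewrite -semigroup_duality//; apply: eq_Rintegral => x _; rewrite mulrC.
  have -> : \int[mu]_x (g x * f x) = \int[mu]_x (f x * g x).
    by apply: eq_Rintegral => x _; rewrite mulrC.
  have -> : \int[mu]_x (f x * Lg x) = \int[mu]_x (Lg x * f x).
    by apply: eq_Rintegral => x _; rewrite mulrC.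
  ring.
apply: (@le_trans _ _ (`|\int[mu]_x ((t^-1 * (semigroup q t g x - g x) - Lg x) * f x)| +
   `|\int[mu]_x ((t^-1 * (semigroup p t f x - f x) - Lf x) * g x)|)%:E).
  by rewrite lee_fin ler_normB.
rewrite addrC EFinD; apply: leeD; apply: normr_Rintegral_le => //.
- apply: measurable_funB => //; apply: measurable_funM => //; exact: measurable_funB.
- move: iF; congr (_.-integrable _ _); apply/funext => x /=; congr EFin; ring.
- apply: measurable_funB => //; apply: measurable_funM => //; exact: measurable_funB.
- move: iG; congr (_.-integrable _ _); apply/funext => x /=; congr EFin; ring.
Unshelve. all: by end_near. Qed.

End markov_duality.

(** * Operators from relations taken up to null sets *)

Section ae_closure.
Context {R : realType} {d : measure_display} {T : measurableType d}.
Variable mu : {measure set T -> \bar R}.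
Implicit Types A B : oper R T.

(** The last hypothesis compares first components equal almost everywhere: agreement of the values
    at identical first components would not make the closure single-valued. *)
Lemma is_operator_ae_closure A :
  A (fun=> 0, fun=> 0) ->
  (forall (a : R[i]) f1 g1 f2 g2, A (f1, g1) -> A (f2, g2) ->
    A (fun x => a * f1 x + f2 x, fun x => a * g1 x + g2 x)) ->
  (forall f1 g1 f2 g2, A (f1, g1) -> A (f2, g2) -> f1 = f2 %[ae mu] -> g1 = g2 %[ae mu]) ->
  is_operator mu (ae_closure mu A).
Proof.
move=> A0 Alin Afun; split.
- by move=> f g [].
- exact: ae_closureK.
- split => /=; [exact: L2C0..|].
  by exists (fun=> 0), (fun=> 0); split => //; exact: ae_refl.
- move=> a f1 g1 f2 g2 [/= hf1 hg1 [f1' [g1' [A1 e1 e2]]]] [/= hf2 hg2 [f2' [g2' [A2 e3 e4]]]].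
  split => /=; [by apply: L2CD => //; exact: L2CZ..|].
  exists (fun x => a * f1' x + f2' x), (fun x => a * g1' x + g2' x); split.
  + exact: Alin.
  + exact: (ae_map2 (fun u v => a * u + v) e1 e3).
  + exact: (ae_map2 (fun u v => a * u + v) e2 e4).
- move=> f g1 g2 [/= hf hg1 [f1' [g1' [A1 e1 e2]]]] [/= _ hg2 [f2' [g2' [A2 e3 e4]]]].
  apply: ae_trans e2 _; apply: ae_trans (ae_sym e4).
  by apply: Afun A1 A2 _; exact: ae_trans (ae_sym e1) e3.
Qed.

End ae_closure.

(** * Doob transforms and Friedrichs extensions *)

Section doob.
Context {R : realType} {d : measure_display} {T : measurableType d}.
Variables (nu m : {measure set T -> \bar R}) (psi : T -> R[i]).
Hypothesis mpsi : cmeas psi.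
Hypothesis mE : forall B, measurable B -> m B = (\int[nu]_(x in B) (sqn (psi x))%:E)%E.
Hypothesis psi_neq0 : \forall x \ae nu, psi x != 0.
Implicit Types f g : T -> R[i].

Let msqn : measurable_fun setT (fun x => sqn (psi x)). Proof. exact: cmeas_sqn. Qed.

Lemma ae_density (P : T -> Prop) : (\forall x \ae nu, P x) -> \forall x \ae m, P x.
Proof.
move=> [N [mN N0 PN]]; exists N; split => //.
rewrite mE// null_set_integral//; apply: measurable_funTS; exact/measurable_EFinP.
Qed.

(** If |psi|^2 integrates to 0 over N, then psi = 0 almost everywhere on N; since psi is nonzero
    almost everywhere, N is [nu]-null. Thus [m] and [nu] have the same null sets. *)
Lemma density_ae (P : T -> Prop) : (\forall x \ae m, P x) -> \forall x \ae nu, P x.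
Proof.
move=> [N [mN N0 PN]].
have mh : measurable_fun N (fun x => (sqn (psi x))%:E).
  by apply: measurable_funTS; exact/measurable_EFinP.
have /(ae_eq_integral_abs _ mN mh) : (\int[nu]_(x in N) `|(sqn (psi x))%:E| = 0)%E.
  rewrite -[RHS]N0 mE//; apply: eq_integral => x _.
  by rewrite gee0_abs// lee_fin sqn_ge0.
apply: filterS2 psi_neq0 => x psix0 Nx0; apply: contrapT => nPx.
by have [/sqn_eq0 /eqP] := Nx0 (PN _ nPx); apply/negP.
Qed.

Lemma ge0_integral_psi (f : T -> R) : measurable_fun setT f -> (forall x, 0 <= f x) ->
  (\int[m]_x (f x)%:E = \int[nu]_x (f x * sqn (psi x))%:E)%E.
Proof.
move=> mf f0; rewrite (@ge0_integral_density _ _ _ nu m (fun x => sqn (psi x)))//.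
- by move=> x; exact: sqn_ge0.
- exact/measurable_EFinP.
Qed.

(** Positive and negative parts are matched separately, so integrability plays no part: both sides
    apply [fine] to the same extended real. *)
Lemma Rintegral_psi (f : T -> R) : measurable_fun setT f ->
  \int[m]_x f x = \int[nu]_x (f x * sqn (psi x)).
Proof.
move=> mf; have mf' : measurable_fun setT (EFin \o f) by exact/measurable_EFinP.
rewrite /Rintegral; congr fine; rewrite integralE [RHS]integralE; congr (_ - _)%E.
- rewrite (@ge0_integral_density _ _ _ nu m (fun x => sqn (psi x)))//; last 2 first.
  + by move=> x; exact: sqn_ge0.
  + exact: measurable_funepos.
  apply: eq_integral => x _; rewrite !funeposE EFinM maxe_pMl ?mul0e ?lee_fin ?sqn_ge0//.
- rewrite (@ge0_integral_density _ _ _ nu m (fun x => sqn (psi x)))//; last 2 first.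
  + by move=> x; exact: sqn_ge0.
  + exact: measurable_funeneg.
  apply: eq_integral => x _; rewrite !funenegE EFinM -mulNe maxe_pMl ?mul0e ?lee_fin ?sqn_ge0//.
Qed.

Lemma norm2_psi f : cmeas f -> norm2 nu (fun x => f x * psi x) = norm2 m f.
Proof.
move=> mf; rewrite !norm2E ge0_integral_psi//; last by move=> x; exact: sqn_ge0.
  by under eq_integral do rewrite sqnM.
exact: cmeas_sqn.
Qed.

Lemma L2C_psi f : L2C m f -> L2C nu (fun x => f x * psi x).
Proof.
move=> /L2CP[mf fin]; apply/L2CP; split; first exact: cmeasM.
by under eq_integral do rewrite sqnM; rewrite -ge0_integral_psi//;
  [exact: cmeas_sqn|move=> x; exact: sqn_ge0].
Qed.

Lemma inner_psi f g : cmeas f -> cmeas g ->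
  inner nu (fun x => f x * psi x) (fun x => g x * psi x) = inner m f g.
Proof.
move=> mf mg; have [mr mi] := cmeasM (cmeas_conj mf) mg.
have psiE (z w u : R[i]) : (z * u)^* * (w * u) = (sqn u)%:C * (z^* * w).
  have <- : u^* * u = (sqn u)%:C.
    by case: u => a b; apply: complex_ext; rewrite /sqn /=; ring.
  by rewrite rmorphM/=; ring.
rewrite /inner /cintegral; congr Complex.
- rewrite Rintegral_psi//; apply: eq_Rintegral => x _.
  by rewrite psiE Re_mulc /= mul0r subr0 mulrC.
- rewrite Rintegral_psi//; apply: eq_Rintegral => x _.
  by rewrite psiE Im_mulc /= mul0r addr0 mulrC.
Qed.

(** Surjectivity of the multiplication by [psi], through which density of a domain passes from
    L^2(m) to L^2(nu). *)
Lemma exists_quotient_psi f : L2C nu f ->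
  exists2 phi, L2C m phi & f = (fun x => phi x * psi x) %[ae nu].
Proof.
move=> hf.
(* The quotient f / psi as f psi^* |psi|^(-2), the real power being a measurable function. *)
pose phi x := f x * ((psi x)^* * (sqn (psi x) `^ (-1))%:C).
have mphi : cmeas phi.
  apply: cmeasM; first exact: (L2C_cmeas hf).
  apply: cmeasM; first exact: cmeas_conj.
  by apply: cmeas_real; apply: measurableT_comp (measurable_powR _) msqn.
have phiE : f = (fun x => phi x * psi x) %[ae nu].
  apply: filterS psi_neq0 => x psix0 _; rewrite /phi powR_inv1 ?sqn_ge0//.
  have sqn0 : sqn (psi x) != 0 by apply: contra_neq psix0; exact: sqn_eq0.
  rewrite -mulrA (_ : _ * _ * psi x = 1) ?mulr1//.
  case: (psi x) sqn0 => a b; rewrite /sqn /= => ab0.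
  by apply: complex_ext; rewrite /=; field.
exists phi => //; apply/L2CP; split => //.
rewrite ge0_integral_psi//; [|exact: cmeas_sqn|by move=> x; exact: sqn_ge0].
have [_] := (L2CP nu f).1 hf; under [in X in _ -> X]eq_integral do rewrite -sqnM.
rewrite (@ae_eq_integral _ _ _ nu setT (fun x => (sqn (phi x * psi x))%:E))//.
- by apply/measurable_EFinP/cmeas_sqn/(L2C_cmeas hf).
- by apply/measurable_EFinP/cmeas_sqn/cmeasM.
- by apply: filterS phiE => x /[apply] ->.
Qed.

Lemma doobI A f g : is_operator m A -> A (f, g) ->
  doob_transform nu psi A (fun x => f x * psi x, fun x => g x * psi x).
Proof.
move=> opA Afg; split => /=.
- exact/L2C_psi/(op_L2C_l opA Afg).
- exact/L2C_psi/(op_L2C_r opA Afg).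
exists (fun x => f x * psi x), (fun x => g x * psi x).
by split => //; [exists f, g|exact: ae_refl|exact: ae_refl].
Qed.

Lemma doobP A F G : doob_transform nu psi A (F, G) -> exists f g,
  [/\ A (f, g), F = (fun x => f x * psi x) %[ae nu] & G = (fun x => g x * psi x) %[ae nu]].
Proof. by move=> [/= _ _ [_ [_ [[f [g [Afg /= -> ->]]] e1 e2]]]]; exists f, g. Qed.

Lemma is_operator_doob A : is_operator m A -> is_operator nu (doob_transform nu psi A).
Proof.
move=> opA; apply: is_operator_ae_closure.
- exists (fun=> 0), (fun=> 0); split => /=; first exact: (op0 opA).
  + by apply/funext => x; rewrite mul0r.
  + by apply/funext => x; rewrite mul0r.
- move=> a _ _ _ _ [f1 [g1 [A1 /= -> ->]]] [f2 [g2 [A2 /= -> ->]]].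
  exists (fun x => a * f1 x + f2 x), (fun x => a * g1 x + g2 x); split => /=.
  + exact: (op_lin a opA A1 A2).
  + by apply/funext => x; rewrite mulrDl mulrA.
  + by apply/funext => x; rewrite mulrDl mulrA.
- move=> _ _ _ _ [f1 [g1 [A1 /= -> ->]]] [f2 [g2 [A2 /= -> ->]]] ff.
  have : g1 = g2 %[ae m].
    apply: (op_uniq opA A1 A2); apply: ae_density; apply: filterS2 psi_neq0 ff.
    by move=> x psix0 + Dx => /(_ Dx) /(mulIf psix0).
  by move=> /density_ae; apply: filterS => x /[apply] ->.
Qed.

Lemma dense_doob A : is_operator m A -> dense_in_L2C m (dom A) ->
  dense_in_L2C nu (dom (doob_transform nu psi A)).
Proof.
move=> opA dA f hf e e0; have [phi hphi phiE] := exists_quotient_psi hf.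
have [h [g Ahg] he] := dA _ hphi _ e0; have hh := op_L2C_l opA Ahg.
exists (fun x => h x * psi x); first by eexists; exact: doobI opA Ahg.
rewrite (@norm2_ae _ _ _ nu _ (fun x => (phi x - h x) * psi x)).
- by rewrite norm2_psi//; exact/(L2C_cmeas (L2CB hphi hh)).
- by apply: (@L2C_cmeas _ _ _ nu); apply: L2CB => //; exact: L2C_psi.
- by apply: (@L2C_cmeas _ _ _ nu); apply: L2C_psi; exact: L2CB.
- by apply: filterS phiE => x /[apply] ->; rewrite mulrBl.
Qed.

Lemma inner_ae_psi F G f g : L2C nu F -> L2C nu G -> cmeas f -> cmeas g ->
  F = (fun x => f x * psi x) %[ae nu] -> G = (fun x => g x * psi x) %[ae nu] ->
  inner nu F G = inner m f g.
Proof.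
move=> hF hG mf mg e1 e2; rewrite -inner_psi//.
apply: inner_ae => //; [exact: L2C_cmeas hF|exact: cmeasM|exact: L2C_cmeas hG|exact: cmeasM].
Qed.

Lemma symmetric_doob A : is_operator m A -> dense_in_L2C m (dom A) ->
  (forall f Af g Ag, A (f, Af) -> A (g, Ag) -> inner m Af g = inner m f Ag) ->
  symmetric_operator nu (doob_transform nu psi A).
Proof.
move=> opA dA sA; have opD := is_operator_doob opA; split => //; first exact: dense_doob.
move=> F1 G1 F2 G2 D1 D2.
have [f1 [g1 [A1 e1 e2]]] := doobP D1; have [f2 [g2 [A2 e3 e4]]] := doobP D2.
have hF1 := op_L2C_l opD D1; have hG1 := op_L2C_r opD D1.
have hF2 := op_L2C_l opD D2; have hG2 := op_L2C_r opD D2.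
have mf1 := L2C_cmeas (op_L2C_l opA A1); have mg1 := L2C_cmeas (op_L2C_r opA A1).
have mf2 := L2C_cmeas (op_L2C_l opA A2); have mg2 := L2C_cmeas (op_L2C_r opA A2).
rewrite (inner_ae_psi hG1 hF2 mg1 mf2 e2 e3) (inner_ae_psi hF1 hG2 mf1 mg2 e1 e4).
exact: sA.
Qed.

Lemma bounded_below_doob A : is_operator m A -> bounded_below m A ->
  bounded_below nu (doob_transform nu psi A).
Proof.
move=> opA [c bA]; have opD := is_operator_doob opA; exists c => F G D.
have [f [g [Afg e1 e2]]] := doobP D.
have mf := L2C_cmeas (op_L2C_l opA Afg); have mg := L2C_cmeas (op_L2C_r opA Afg).
have hF := op_L2C_l opD D; have hG := op_L2C_r opD D.
rewrite (inner_ae_psi hF hG mf mg e1 e2) (norm2_ae (L2C_cmeas hF) _ e1); last exact: cmeasM.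
by rewrite norm2_psi//; exact: bA.
Qed.

End doob.

Section shift.
Context {R : realType} {d : measure_display} {T : measurableType d}.
Variable mu : {measure set T -> \bar R}.
Implicit Types A : oper R T.

Lemma conjc_realC (E : R) : (E%:C)^* = E%:C :> R[i].
Proof. by apply: complex_ext; rewrite /= ?oppr0. Qed.

Lemma symmetric_shift A (E : R) : symmetric_operator mu A ->
  symmetric_operator mu (shift_op A E).
Proof.
move=> [opA dA sA]; split; first exact: is_operator_shift.
  move=> f hf e e0; have [h [g Ahg] he] := dA f hf e e0.
  by exists h => //; exists (fun x => g x + E%:C * h x), g.
move=> f _ g _ /shift_opP[f' Af ->] /shift_opP[g' Ag ->].
have hf := op_L2C_l opA Af; have hf' := op_L2C_r opA Af.
have hg := op_L2C_l opA Ag; have hg' := op_L2C_r opA Ag.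
rewrite innerDl ?innerDr ?innerZl ?innerZr//; try exact: L2CZ.
by rewrite (sA _ _ _ _ Af Ag) conjc_realC.
Qed.

Lemma bounded_below_shift A (E : R) : is_operator mu A -> bounded_below mu A ->
  bounded_below mu (shift_op A E).
Proof.
move=> opA [c bA]; exists (c + E) => f _ /shift_opP[f' Af ->].
have hf := op_L2C_l opA Af; have hf' := op_L2C_r opA Af.
rewrite innerDr ?innerZr//; last exact: L2CZ.
rewrite innerxx// mulrDl; have := bA _ _ Af.
by case: (inner mu f f') => a b /=; rewrite mul0r subr0 lerD2r.
Qed.

(** Symmetry puts the graph inside that of the adjoint, and the constant sequence puts the domain
    inside the form domain. *)
Lemma friedrichs_extends A f g : symmetric_operator mu A -> A (f, g) ->
  friedrichs mu A (f, g).
Proof.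
move=> [opA dA sA] Afg.
have hf := op_L2C_l opA Afg; have hg := op_L2C_r opA Afg; split.
  by split => //= h Ah Ahh; exact: sA.
split => //; exists (fun=> f), (fun=> g); split => //.
  rewrite (_ : (fun _ => _) = fun=> 0%E); first exact: cvg_cst.
  apply/funext => k; rewrite norm2E (_ : (fun x => _) = fun=> 0%E); last first.
    by apply/funext => x; rewrite subrr /sqn /= expr0n/= addr0.
  by rewrite integral0 poweR0r// invr_neq0.
move=> e e0; exists 0%N => j k _ _.
rewrite (_ : inner _ _ _ = 0) ?Normc.normc0//.
rewrite (_ : (fun x => f x - f x) = fun x => 0 * f x); last first.
  by apply/funext => x; rewrite subrr mul0r.
by rewrite innerZl ?rmorph0 ?mul0r//; exact: L2CB.
Qed.

End shift.

(** * The time derivative *)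

Lemma ae_impl2 {R : realType} {d : measure_display} {T : measurableType d}
    (mu : {measure set T -> \bar R}) (P Q S : T -> Prop) :
  (forall x, P x -> Q x -> S x) ->
  (\forall x \ae mu, P x) -> (\forall x \ae mu, Q x) -> \forall x \ae mu, S x.
Proof. by move=> PQS; apply: filterS2. Qed.

Section absolute_continuity.
Context {R : realType}.
Implicit Types (a b : R) (f g c : R -> R).

Lemma absolutely_continuous_cst a b (r : R) : absolutely_continuous_on a b (fun=> r).
Proof.
move=> e e0; exists 1 => // m s t _ _ _.
by rewrite big1// => k _; rewrite subrr normr0.
Qed.

Lemma absolutely_continuousD a b f g : absolutely_continuous_on a b f ->
  absolutely_continuous_on a b g -> absolutely_continuous_on a b (fun x => f x + g x).
Proof.
move=> hf hg e e0; have e20 : 0 < e / 2 by rewrite divr_gt0.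
have [d1 d10 h1] := hf _ e20; have [d2 d20 h2] := hg _ e20.
exists (Num.min d1 d2); first by rewrite lt_min d10.
move=> m s t hst disj; rewrite lt_min => /andP[hs1 hs2].
apply: (@le_lt_trans _ _ (\sum_(k < m) (`|f (t k) - f (s k)| + `|g (t k) - g (s k)|))).
  apply: ler_sum => k _; apply: le_trans (ler_normD _ _).
  by rewrite le_eqVlt; apply/orP; left; apply/eqP; congr `|_|; ring.
by rewrite big_split/= (splitr e); apply: ltrD; [exact: h1|exact: h2].
Qed.

Lemma absolutely_continuousZ a b (r : R) f : absolutely_continuous_on a b f ->
  absolutely_continuous_on a b (fun x => r * f x).
Proof.
move=> hf e e0; have r0 : 0 < `|r| + 1 by rewrite ltr_wpDl.
have [d1 d10 h1] := hf _ (divr_gt0 e0 r0); exists d1 => // m s t hst disj hs.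
apply: (@le_lt_trans _ _ ((`|r| + 1) * \sum_(k < m) `|f (t k) - f (s k)|)).
  rewrite mulr_sumr; apply: ler_sum => k _; rewrite -mulrBr normrM.
  by rewrite ler_wpM2r// lerDl.
by rewrite mulrC -ltr_pdivlMr//; exact: h1.
Qed.

Lemma absolutely_continuous_continuous f :
  (forall a b, absolutely_continuous_on a b f) -> continuous f.
Proof.
move=> acf x; apply/cvgrPdist_lt => e e0.
have [d d0 hd] := acf (x - 1) (x + 1) e e0.
near=> y.
have yx : `|x - y| < Num.min 1 d.
  by near: y; apply: (@cvgr_dist_lt _ R^o) => //; rewrite lt_min ltr01.
move: yx; rewrite lt_min => /andP[yx1 yxd].
have key u v : u <= v -> x - 1 <= u -> v <= x + 1 -> v - u < d -> `|f v - f u| < e.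
  move=> uv xu vx vud; have := hd 1%N (fun=> u) (fun=> v).
  rewrite !big_ord1; apply => //.
  by move=> j k; rewrite !ord1 eqxx.
move: yx1 yxd; have [xy|yx] := leP x y.
  by rewrite distrC ger0_norm ?subr_ge0// => h1 h2; rewrite distrC; apply: key => //; lra.
by rewrite ger0_norm ?subr_ge0 ?ltW// => h1 h2; apply: key => //; lra.
Unshelve. all: by end_near. Qed.

(** An increment of f c splits as (f(t) - f(s)) c(t) + f(s) (c(t) - c(s)); the first term is
    controlled by |c| <= 1, the second by a bound M of |f| on [a, b] and the Lipschitz constant of
    c. *)
Lemma absolutely_continuousM_Lipschitz a b (K : R) f c : 0 <= K ->
  (forall u v, `|c v - c u| <= K * `|v - u|) -> (forall u, `|c u| <= 1) ->
  (forall u v, absolutely_continuous_on u v f) ->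
  absolutely_continuous_on a b (fun x => f x * c x).
Proof.
move=> K0 lipc c1 acf e e0.
have [M M0 fM] : exists2 M, 0 <= M & forall x, a <= x <= b -> `|f x| <= M.
  have [ab|ab] := leP a b; last first.
    exists 0 => // x /andP[ax xb]; exfalso.
    by have := le_trans ax xb; rewrite leNgt ab.
  have cf : {within `[a, b], continuous (fun x => `|f x|)}.
    apply: continuous_subspaceT => x; apply: continuous_comp; last exact: norm_continuous.
    exact: absolutely_continuous_continuous.
  by have [z zab hz] := EVT_max ab cf; exists `|f z|.
have MK0 : 0 < M * K + 1 by rewrite ltr_wpDl// mulr_ge0.
have e20 : 0 < e / 2 by rewrite divr_gt0.
have [d d0 hd] := acf a b _ e20.
(* Half of e goes to the variation of f and half to M K times the total length; the 1 keeps the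
   denominator positive. *)
exists (Num.min d (e / 2 / (M * K + 1))); first by rewrite lt_min d0 divr_gt0.
move=> m s t hst disj; rewrite lt_min => /andP[hs1 hs2].
apply: (@le_lt_trans _ _ (\sum_(k < m) `|f (t k) - f (s k)| +
    (M * K) * \sum_(k < m) (t k - s k))).
  rewrite mulr_sumr -big_split/=; apply: ler_sum => k _.
  have [ask skt tkb] := hst k.
  have -> : f (t k) * c (t k) - f (s k) * c (s k) =
    (f (t k) - f (s k)) * c (t k) + f (s k) * (c (t k) - c (s k)) by ring.
  apply: le_trans (ler_normD _ _) _; rewrite !normrM; apply: lerD.
    by rewrite ler_piMr.
  rewrite -mulrA; apply: ler_pM => //.
    by apply: fM; rewrite ask (le_trans skt).
  by apply: le_trans (lipc _ _) _; rewrite ger0_norm// subr_ge0.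
rewrite [ltRHS]splitr; apply: ltr_leD; first exact: hd.
apply: (@le_trans _ _ ((M * K + 1) * \sum_(k < m) (t k - s k))).
  rewrite ler_wpM2r ?lerDl// sumr_ge0// => k _.
  by have [_ ? _] := hst k; rewrite subr_ge0.
by rewrite mulrC -ler_pdivlMr// ltW.
Qed.

End absolute_continuity.

Section time_derivative.
Context {R : realType}.
Local Notation leb := (@lebesgue_measure R).

(** Two continuous functions that differ at a point differ on a ball, which has positive measure.
    Hence the absolutely continuous representative is unique, and so is the derivative it
    defines. *)
Lemma continuous_ae_eq (f g : R -> R) : continuous f -> continuous g ->
  f = g %[ae leb] -> f = g.
Proof.
move=> cf cg [N [mN N0 hN]]; apply/funext => x; apply: contrapT => /eqP fgx.
have : \forall y \near x, f y - g y != 0.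
  have cfg : {for x, continuous (fun y => f y - g y)} by apply: cvgB; [exact: cf|exact: cg].
  apply: (cvgr_neq0 _ cfg); by rewrite subr_eq0.
move=> [e /= e0 he].
have ballN : ball x e `<=` N.
  move=> y /he; rewrite subr_eq0 => /eqP nfg; apply: hN => /= h; exact/nfg/h.
have : (leb (ball x e) <= 0)%E.
  apply: (@le_trans _ _ (leb N)); last by rewrite le_eqVlt; apply/orP; left; apply/eqP.
  by apply: (@le_measure _ _ _ leb (ball x e) N) => //; rewrite inE//; exact: measurable_ball.
move=> le0; have : e *+ 2 <= 0 by rewrite -lee_fin -(lebesgue_measure_ball x (ltW e0)).
by rewrite leNgt pmulrn_rgt0 ?e0.
Qed.

Lemma Lfun2M_bounded (f c : R -> R) (K : R) : f \in Lfun leb 2%:E ->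
  measurable_fun setT c -> (forall x, `|c x| <= K) ->
  (fun x => f x * c x) \in Lfun leb 2%:E.
Proof.
move=> hf mc cK; have [mf fin] := (Lfun2P leb f).1 hf.
apply/Lfun2P; split; first exact: measurable_funM.
have [_ fin'] := (Lfun2P leb _).1 (Lfun2Z K hf).
apply: ge0_integral_lty_le fin'.
- by apply: measurable_funX; exact: measurable_funM.
- by apply: measurable_funX; exact: measurable_funM.
- move=> x; rewrite sqr_ge0/= !exprMn mulrC ler_wpM2r ?sqr_ge0//.
  rewrite -(real_normK (num_real (c x))) ler_sqr ?nnegrE//.
  by apply: le_trans (cK x).
Qed.

(** Meant for c = cos(a t) or sin(a t) with K = |a|. The mean value theorem turns the bound on c'
    into the Lipschitz estimate. *)
Lemma time_deriv_realM (f f' c c' : R -> R) (K : R) : 0 <= K ->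
  (forall x, `|c x| <= 1) -> (forall x, `|c' x| <= K) ->
  measurable_fun setT c -> measurable_fun setT c' ->
  (forall x : R, is_derive x (1 : R) c (c' x)) ->
  time_deriv_real (f, f') ->
  time_deriv_real (fun x => f x * c x, fun x => f' x * c x + f x * c' x).
Proof.
move=> K0 c1 cK mc mc' dc [/= hf hf' [g [fg acg dg]]].
have cc : continuous c by move=> x; apply: differentiable_continuous; exact/derivable1_diffP.
have lipc u v : `|c v - c u| <= K * `|v - u|.
  have main a b : a <= b -> `|c b - c a| <= K * `|b - a|.
    move=> ab; have [] := @MVT_segment R c c' a b ab.
    - exact: continuous_subspaceT.
    - by move=> z _ ->; rewrite normrM ler_wpM2r.
  have [uv|/ltW vu] := leP u v; first exact: main.
  by rewrite distrC [`|v - u|]distrC; exact: main.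
split => /=.
- exact: Lfun2M_bounded c1.
- by apply: Lfun2D; [exact: Lfun2M_bounded c1|exact: Lfun2M_bounded cK].
exists (fun x => g x * c x); split.
- by apply: filterS fg => x /[apply] ->.
- by move=> a b; exact: absolutely_continuousM_Lipschitz lipc c1 acg.
- apply: (ae_impl2 _ fg dg) => x /(_ I) -> dgx.
  have := is_deriveM dgx (dc x); rewrite /GRing.scale/= => h.
  by rewrite addrC [f' x * _]mulrC; exact: h.
Qed.

Lemma is_real_operator_time_deriv : is_real_operator leb (@time_deriv_real R).
Proof.
split.
- by move=> f g [].
- move=> f g f' g' [/= hf hg [u [fu acu du]]] hf' hg' ff' gg'; split => //=.
  exists u; split => //; first exact: ae_trans ff' fu.
  by apply: filterS2 gg' du => x /(_ I) ->.
- split => /=; [exact: Lfun2_cst0..|].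
  exists (fun=> 0); split; first exact: ae_refl.
  + by move=> a b; exact: absolutely_continuous_cst.
  + by apply: nearW => x; exact: is_derive_cst.
- move=> a f1 g1 f2 g2 [/= hf1 hg1 [u1 [fu1 ac1 d1]]] [/= hf2 hg2 [u2 [fu2 ac2 d2]]].
  split => /=; [by apply: Lfun2D => //; exact: Lfun2Z..|].
  exists (fun x => a * u1 x + u2 x); split.
  + exact: (ae_map2 (fun u v => a * u + v) fu1 fu2).
  + by move=> s t; apply: absolutely_continuousD => //; exact: absolutely_continuousZ.
  + apply: (ae_impl2 _ d1 d2) => x {}d1 {}d2.
    exact: (is_deriveD (is_deriveZ a d1) d2).
- move=> f g1 g2 [/= _ _ [u1 [fu1 ac1 d1]]] [/= _ _ [u2 [fu2 ac2 d2]]].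
  have u12 : u1 = u2.
    apply: continuous_ae_eq; [exact: absolutely_continuous_continuous..|].
    exact: ae_trans (ae_sym fu1) fu2.
  rewrite -u12 in d2; apply: (ae_impl2 _ d1 d2) => x {}d1 {}d2 _.
  by have [_ <-] := d1; have [_ <-] := d2.
Qed.

Lemma is_operator_time_deriv : is_operator leb (@time_deriv R).
Proof. exact/is_operator_complexify/is_real_operator_time_deriv. Qed.

(** Stability of H^1 under a phase: the space-time Doob transform multiplies time factors by
    e^(-iEt), and its inverse by e^(iEt). *)
Lemma time_deriv_expi (a : R) (f f' : R -> R[i]) : time_deriv (f, f') ->
  time_deriv (fun t => f t * expi (a * t),
              fun t => (f' t + 'i%C * a%:C * f t) * expi (a * t)).
Proof.
move=> [/= dr di].
have mcos : measurable_fun setT (fun t => cos (a * t)).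
  apply: measurableT_comp => //; apply: continuous_measurable_fun; exact: continuous_cos.
have msin : measurable_fun setT (fun t => sin (a * t)).
  apply: measurableT_comp => //; apply: continuous_measurable_fun; exact: continuous_sin.
have da (x : R) : is_derive x (1 : R) (fun t => a * t) a.
  have := is_deriveZ a (is_derive_id x (1 : R)); rewrite /GRing.scale/= mulr1.
  exact.
have cosM g g' : time_deriv_real (g, g') -> time_deriv_real
    (fun t => g t * cos (a * t), fun t => g' t * cos (a * t) + g t * (- sin (a * t) * a)).
  apply: (@time_deriv_realM _ _ _ _ `|a|) => //.
  - by move=> x; rewrite ler_norml cos_geN1 cos_le1.
  - by move=> x; rewrite normrM normrN ler_piMl// ler_norml sin_geN1 sin_le1.
  - by apply: measurable_funM => //; exact: measurableT_comp.
have sinM g g' : time_deriv_real (g, g') -> time_deriv_real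
    (fun t => g t * sin (a * t), fun t => g' t * sin (a * t) + g t * (cos (a * t) * a)).
  apply: (@time_deriv_realM _ _ _ _ `|a|) => //.
  - by move=> x; rewrite ler_norml sin_geN1 sin_le1.
  - by move=> x; rewrite normrM ler_piMl// ler_norml cos_geN1 cos_le1.
  - exact: measurable_funM.
have [_ _ _ lin _] := is_real_operator_time_deriv.
split => /=.
- have := lin (-1) _ _ _ _ (sinM _ _ di) (cosM _ _ dr).
  congr (time_deriv_real (_, _)); apply/funext => t; case: (f t) (f' t) => x y [x' y'] /=; ring.
- have := lin 1 _ _ _ _ (cosM _ _ di) (sinM _ _ dr).
  congr (time_deriv_real (_, _)); apply/funext => t; case: (f t) (f' t) => x y [x' y'] /=; ring.
Qed.

End time_derivative.

(** * Tensor products *)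

Lemma ae_forall_ord {R : realType} {d : measure_display} {T : measurableType d}
    (mu : {measure set T -> \bar R}) (m : nat) (P : 'I_m -> T -> Prop) :
  (forall k, \forall x \ae mu, P k x) -> \forall x \ae mu, forall k, P k x.
Proof.
move=> hP.
have := @ae_foralln _ _ R mu (fun i x => forall k : 'I_m, k = i :> nat -> P k x).
move=> h; apply: filterS (h _) => [x hx k|i]; first exact: hx.
have [im|im] := ltnP i m; last first.
  by apply: nearW => x k ki; move: im; rewrite -ki leqNgt ltn_ord.
apply: filterS (hP (Ordinal im)) => x e k ki.
by rewrite (_ : k = Ordinal im)//; exact: val_inj.
Qed.

Section free_family.
Context {R : realType} {d : measure_display} {T : measurableType d}.
Variable mu : {measure set T -> \bar R}.

Definition ae_free (r : nat) (h : 'I_r -> T -> R[i]) : Prop :=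
  forall c : 'I_r -> R[i],
    (\forall x \ae mu, \sum_(j < r) c j * h j x = 0) -> forall j, c j = 0.

(** Extraction of a basis modulo null sets: as long as a nontrivial relation holds, a member with a
    nonzero coefficient is dropped and expressed through the others. *)
Lemma exists_ae_free_subfamily (m : nat) (g : 'I_m -> T -> R[i]) :
  exists (r : nat) (s : 'I_r -> 'I_m) (c : 'I_m -> 'I_r -> R[i]),
    ae_free (fun j => g (s j)) /\
    forall k, \forall x \ae mu, g k x = \sum_(j < r) c k j * g (s j) x.
Proof.
elim: m g => [|m IH] g.
  by exists 0%N, id, (fun _ _ => 0); split => [c _ []//|[]//].
have [free|] := pselect (ae_free g).
  exists m.+1, id, (fun k j => (k == j)%:R); split => // k.
  apply: nearW => x; rewrite (bigD1 k)//= eqxx mul1r big1 ?addr0// => j jk.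
  by rewrite eq_sym (negbTE jk) mul0r.
move=> /existsNP[c /not_implyP[c0 /existsNP[j0 /eqP cj0]]].
have [r [s [c' [free span]]]] := IH (fun k => g (lift j0 k)).
exists r, (fun j => lift j0 (s j)), (fun k j => if unlift j0 k is Some k' then c' k' j
  else - (c j0)^-1 * \sum_(k' < m) c (lift j0 k') * c' k' j); split => // k.
case: unliftP => [k' ->|->]; first exact: span.
apply: (ae_impl2 _ c0 (ae_forall_ord span)) => x; rewrite (bigD1_ord j0)//= => h sp.
have -> : g j0 x = - (c j0)^-1 * \sum_(k' < m) c (lift j0 k') * g (lift j0 k') x.
  apply: (mulfI cj0); rewrite mulrA mulrN mulfV// mulN1r.
  by apply/eqP; rewrite -addr_eq0 h.
under [in RHS]eq_bigr do rewrite -mulrA mulr_suml.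
rewrite -mulr_sumr; congr (_ * _); rewrite [RHS]exchange_big/=.
by apply: eq_bigr => k' _; rewrite [in LHS]sp mulr_sumr; apply: eq_bigr => j _; rewrite mulrA.
Qed.

End free_family.

Section product_tools.
Context {R : realType} {d1 d2 : measure_display}
  {T1 : measurableType d1} {T2 : measurableType d2}.
Variables (m1 : {measure set T1 -> \bar R})
  (m2 : {sigma_finite_measure set T2 -> \bar R}).

Lemma ae_fst (P : T1 -> Prop) : (\forall x \ae m1, P x) -> \forall z \ae (m1 \x m2)%E, P z.1.
Proof.
move=> [N [mN N0 hN]]; exists (N `*` setT); split.
- exact: measurableX.
- by rewrite product_measure1E// N0 mul0e.
- by move=> z /= /hN.
Qed.

Lemma ae_snd (P : T2 -> Prop) : (\forall x \ae m2, P x) -> \forall z \ae (m1 \x m2)%E, P z.2.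
Proof.
move=> [N [mN N0 hN]]; exists (setT `*` N); split.
- exact: measurableX.
- by rewrite product_measure1E// N0 mule0.
- by move=> z /= /hN.
Qed.

Lemma cmeas_fst (f : T1 -> R[i]) : cmeas f -> cmeas (fun z : T1 * T2 => f z.1).
Proof. by move=> [fr fi]; split; [exact: measurableT_comp fr _|exact: measurableT_comp fi _]. Qed.

Lemma cmeas_snd (f : T2 -> R[i]) : cmeas f -> cmeas (fun z : T1 * T2 => f z.2).
Proof. by move=> [fr fi]; split; [exact: measurableT_comp fr _|exact: measurableT_comp fi _]. Qed.

Lemma L2C_tensor (f : T1 -> R[i]) (g : T2 -> R[i]) : L2C m1 f -> L2C m2 g ->
  L2C (m1 \x m2)%E (fun z => f z.1 * g z.2).
Proof.
move=> /L2CP[mf ff] /L2CP[mg fg]; apply/L2CP.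
have mfg : cmeas (fun z : T1 * T2 => f z.1 * g z.2).
  by apply: cmeasM; [exact: cmeas_fst|exact: cmeas_snd].
split => //; rewrite ge0_integral_prod; last 2 first.
- by apply/measurable_EFinP; exact: cmeas_sqn.
- by move=> z; rewrite lee_fin sqn_ge0.
have g0 : (0 <= \int[m2]_y (sqn (g y))%:E)%E.
  by apply: integral_ge0 => y _; rewrite lee_fin sqn_ge0.
rewrite (@eq_integral _ _ _ m1 setT (fun x => (sqn (f x))%:E * \int[m2]_y (sqn (g y))%:E)%E).
  rewrite ge0_integralZr//.
  - rewrite lte_mul_pinfty//; first by apply: integral_ge0 => x _; rewrite lee_fin sqn_ge0.
    by rewrite ge0_fin_numE//; apply: integral_ge0 => x _; rewrite lee_fin sqn_ge0.
  - by apply/measurable_EFinP; exact: cmeas_sqn.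
  - by move=> x _; rewrite lee_fin sqn_ge0.
move=> x _ /=; under eq_integral do rewrite sqnM EFinM.
rewrite ge0_integralZl// ?lee_fin ?sqn_ge0//.
- by apply/measurable_EFinP; exact: cmeas_sqn.
- by move=> y _; rewrite lee_fin sqn_ge0.
Qed.

(** For almost every fixed x the equality is a linear relation between the h_j with coefficients
    phi_j(x) - psi_j(x), which therefore vanish. *)
Lemma ae_free_tensor (r : nat) (h : 'I_r -> T2 -> R[i]) (phi psi : 'I_r -> T1 -> R[i]) :
  ae_free m2 h ->
  (\forall z \ae (m1 \x m2)%E,
    \sum_(j < r) phi j z.1 * h j z.2 = \sum_(j < r) psi j z.1 * h j z.2) ->
  forall j, phi j = psi j %[ae m1].
Proof.
move=> free /ae_prod; move=> hx j; apply: filterS hx => x hx _.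
apply/eqP; rewrite -subr_eq0; apply/eqP.
apply: (free (fun j => phi j x - psi j x)); apply: filterS hx => y /= e.
by under eq_bigr do rewrite mulrBl; rewrite sumrB e subrr.
Qed.

End product_tools.

Section tensor.
Context {R : realType} {d1 d2 : measure_display}
  {T1 : measurableType d1} {T2 : measurableType d2}.
Variables (m1 : {measure set T1 -> \bar R})
  (m2 : {sigma_finite_measure set T2 -> \bar R}).
Implicit Types (A : oper R T1) (B : oper R T2).
Local Notation m12 := (m1 \x m2)%E.

Definition tensor_elt (r : nat) (f : 'I_r -> T1 -> R[i]) (g : 'I_r -> T2 -> R[i]) :
    T1 * T2 -> R[i] :=
  fun z => \sum_(k < r) f k z.1 * g k z.2.

Definition tensor_val (r : nat) (f Af : 'I_r -> T1 -> R[i]) (g Bg : 'I_r -> T2 -> R[i]) :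
    T1 * T2 -> R[i] :=
  fun z => \sum_(k < r) (Af k z.1 * g k z.2 + f k z.1 * Bg k z.2).

Lemma tensor_sumP A B F G : tensor_sum m1 m2 A B (F, G) ->
  exists (r : nat) (f Af : 'I_r -> T1 -> R[i]) (g Bg : 'I_r -> T2 -> R[i]),
  [/\ forall k, A (f k, Af k), forall k, B (g k, Bg k),
      F = tensor_elt f g %[ae m12] & G = tensor_val f Af g Bg %[ae m12]].
Proof.
by move=> [/= _ _ [_ [_ [[r [f [Af [g [Bg [hA hB /= -> ->]]]]]] e1 e2]]]];
  exists r, f, Af, g, Bg.
Qed.

Lemma tensor_sumI A B F G (r : nat) (f Af : 'I_r -> T1 -> R[i]) (g Bg : 'I_r -> T2 -> R[i]) :
  (forall k, A (f k, Af k)) -> (forall k, B (g k, Bg k)) -> L2C m12 F -> L2C m12 G ->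
  F = tensor_elt f g %[ae m12] -> G = tensor_val f Af g Bg %[ae m12] ->
  tensor_sum m1 m2 A B (F, G).
Proof.
move=> hA hB hF hG e1 e2; split => //=; exists (tensor_elt f g), (tensor_val f Af g Bg).
by split => //; exists r, f, Af, g, Bg.
Qed.

Lemma L2C_tensor_elt (r : nat) (f : 'I_r -> T1 -> R[i]) (g : 'I_r -> T2 -> R[i]) :
  (forall k, L2C m1 (f k)) -> (forall k, L2C m2 (g k)) -> L2C m12 (tensor_elt f g).
Proof.
move=> hf hg; apply: (@L2C_sum _ _ _ m12 r (fun k z => f k z.1 * g k z.2)) => k.
exact: L2C_tensor.
Qed.

Lemma L2C_tensor_val (r : nat) (f Af : 'I_r -> T1 -> R[i]) (g Bg : 'I_r -> T2 -> R[i]) :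
  (forall k, L2C m1 (f k)) -> (forall k, L2C m1 (Af k)) ->
  (forall k, L2C m2 (g k)) -> (forall k, L2C m2 (Bg k)) -> L2C m12 (tensor_val f Af g Bg).
Proof.
move=> hf hAf hg hBg.
apply: (@L2C_sum _ _ _ m12 r (fun k z => Af k z.1 * g k z.2 + f k z.1 * Bg k z.2)) => k.
by apply: L2CD; exact: L2C_tensor.
Qed.

(** The same coefficients serve for elements and values: [B] is linear and single-valued, so g_k =
    \sum_j c_kj h_j forces B g_k = \sum_j c_kj B h_j almost everywhere. *)
Lemma tensor_change_basis B (m r : nat) (f Af : 'I_m -> T1 -> R[i])
    (g Bg : 'I_m -> T2 -> R[i]) (h Bh : 'I_r -> T2 -> R[i]) (c : 'I_m -> 'I_r -> R[i]) :
  is_operator m2 B ->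
  (forall k, B (g k, Bg k)) -> (forall j, B (h j, Bh j)) ->
  (forall k, \forall x \ae m2, g k x = \sum_(j < r) c k j * h j x) ->
  tensor_elt f g = tensor_elt (fun j x => \sum_(k < m) c k j * f k x) h %[ae m12] /\
  tensor_val f Af g Bg = tensor_val (fun j x => \sum_(k < m) c k j * f k x)
    (fun j x => \sum_(k < m) c k j * Af k x) h Bh %[ae m12].
Proof.
move=> opB hB hBh span.
have Bspan k : \forall x \ae m2, Bg k x = \sum_(j < r) c k j * Bh j x.
  have e : g k = (fun x => \sum_(j < r) c k j * h j x) %[ae m2].
    by apply: filterS (span k) => x ->.
  have := op_uniq opB (hB k) (op_sum (c k) opB hBh) e.
  by apply: filterS => x /(_ I).
have swap (u : 'I_m -> T1 -> R[i]) (v : 'I_m -> T2 -> R[i]) (w : 'I_r -> T2 -> R[i]) x y :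
    (forall k, v k y = \sum_(j < r) c k j * w j y) ->
    \sum_(k < m) u k x * v k y = \sum_(j < r) (\sum_(k < m) c k j * u k x) * w j y.
  move=> vw; under eq_bigr do rewrite vw mulr_sumr.
  rewrite exchange_big/=; apply: eq_bigr => j _; rewrite mulr_suml.
  by apply: eq_bigr => k _; rewrite mulrA [u k x * _]mulrC.
split.
- apply: filterS (ae_snd m1 (ae_forall_ord span)) => z hz _.
  exact: swap.
- apply: (ae_impl2 _ (ae_snd m1 (ae_forall_ord span)) (ae_snd m1 (ae_forall_ord Bspan))).
  move=> z hz hBz _; rewrite /tensor_val !big_split/=; congr (_ + _); exact: swap.
Qed.

(** The time derivative enters the forward generator with sign + and the backward one with sign -,
    so this is its coefficient in K^Y. *)
Lemma K_coef_sub : K_coef - K_coef^* = - 'i%C :> R[i].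
Proof. by apply: complex_ext; rewrite /=; field. Qed.

(* An element of the intersection of the two domains is a sum of simple tensors
   in two ways.  Rewriting both sums on an independent subfamily of all the time
   factors forces the space factors to agree, hence to lie in D(A1) and D(A2). *)
Lemma K_op_tensor A1 A2 B : is_operator m1 A1 -> is_operator m1 A2 -> is_operator m2 B ->
  K_op (tensor_sum m1 m2 A1 B) (tensor_sum m1 m2 A2 (scale_op (-1) B)) =
  tensor_sum m1 m2 (K_op A1 A2) (scale_op (- 'i%C) B).
Proof.
move=> opA1 opA2 opB.
have opNB : is_operator m2 (scale_op (-1) B).
  by apply: is_operator_scale => //; rewrite oppr_eq0 oner_eq0.
apply/seteqP; split => [[F G]|[F G]].
- move=> /K_opP[a [b [Fa Fb GE]]].
  have [hF ha] := ae_closure_L2C Fa; have [_ hb] := ae_closure_L2C Fb.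
  have [n1 [f1 [Af1 [g1 [Bg1 [hA1 hB1 F1 a1]]]]]] := tensor_sumP Fa.
  have [n2 [f2 [Af2 [g2 [Bg2 [hA2 hB2 F2 b2]]]]]] := tensor_sumP Fb.
  (* Both families of time factors are concatenated, so that a single free subfamily spans the
     two. *)
  pose gg (k : 'I_(n1 + n2)) := match fintype.split k with inl i => g1 i | inr i => g2 i end.
  have hgg k : exists Bgk, B (gg k, Bgk).
    rewrite /gg; case: (fintype.split k) => i; first by exists (Bg1 i).
    by have [Bg] := hB2 i; exists Bg.
  have [r [s [c [free span]]]] := exists_ae_free_subfamily m2 gg.
  have [Bh hBh] := choice (fun j => hgg (s j)).
  have hNBh j : scale_op (-1) B (gg (s j), fun x => -1 * Bh j x).
    exact: scale_opI.
  have span1 i : \forall x \ae m2, g1 i x = \sum_(j < r) c (lshift n2 i) j * gg (s j) x.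
    have := span (lshift n2 i); apply: filterS => x <-.
    by rewrite /gg (unsplitK (inl i)).
  have span2 i : \forall x \ae m2, g2 i x = \sum_(j < r) c (rshift n1 i) j * gg (s j) x.
    have := span (rshift n1 i); apply: filterS => x <-.
    by rewrite /gg (unsplitK (inr i)).
  have [e1 e1'] := tensor_change_basis f1 Af1 opB hB1 hBh span1.
  have [e2 e2'] := tensor_change_basis f2 Af2 opNB hB2 hNBh span2.
  set phi1 := fun j x => \sum_(k < n1) c (lshift n2 k) j * f1 k x in e1 e1'.
  set phi2 := fun j x => \sum_(k < n2) c (rshift n1 k) j * f2 k x in e2 e2'.
  set Aphi1 := fun j x => \sum_(k < n1) c (lshift n2 k) j * Af1 k x in e1'.
  set Aphi2 := fun j x => \sum_(k < n2) c (rshift n1 k) j * Af2 k x in e2'.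
  have hphi1 j : A1 (phi1 j, Aphi1 j) by exact: (op_sum (fun k => c (lshift n2 k) j) opA1 hA1).
  have hphi2 j : A2 (phi2 j, Aphi2 j) by exact: (op_sum (fun k => c (rshift n1 k) j) opA2 hA2).
  have phi12 : forall j, phi1 j = phi2 j %[ae m1].
    apply: ae_free_tensor free _.
    have := ae_trans (ae_sym (ae_trans F1 e1)) (ae_trans F2 e2).
    by apply: filterS => z /(_ I).
  have hphi j : A2 (phi1 j, Aphi2 j).
    apply: (op_ae opA2 (hphi2 j)) => //; last exact: ae_refl.
    + exact: op_L2C_l (hphi1 j).
    + exact: op_L2C_r (hphi2 j).
  have hG : L2C m12 G by rewrite GE; apply: L2CD; exact: L2CZ.
  apply: (tensor_sumI (f := phi1) (Af := fun j x => K_coef * Aphi1 j x + K_coef^* * Aphi2 j x)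
    (g := fun j => gg (s j)) (Bg := fun j x => - 'i%C * Bh j x)) => //.
  + by move=> j; exact: K_opI.
  + by move=> j; exact: scale_opI.
  + exact: ae_trans F1 e1.
  + have b2' := ae_trans b2 e2'; have a1' := ae_trans a1 e1'.
    have phi12' : \forall x \ae m1, forall j, phi1 j x = phi2 j x.
      by apply: ae_forall_ord => j; apply: filterS (phi12 j) => x /(_ I).
    have phiz := ae_fst m2 phi12'.
    apply: (ae_impl2 _ (ae_map2 (fun u v => K_coef * u + K_coef^* * v) a1' b2') phiz).
    move=> z /(_ I) ez hz _; rewrite GE [LHS]ez /tensor_val !mulr_sumr -big_split/=.
    apply: eq_bigr => j _; rewrite -hz -K_coef_sub; ring.
- move=> FG; have [hF hG] := ae_closure_L2C FG.
  have [r [f [Kf [g [Bg [hK hB e1 e2]]]]]] := tensor_sumP FG.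
  have [Af hAf] := @choice _ _ (fun k (u : (T1 -> R[i]) * (T1 -> R[i])) =>
      [/\ A1 (f k, u.1), A2 (f k, u.2) &
          Kf k = (fun x => K_coef * u.1 x + K_coef^* * u.2 x)])
    (fun k => let: ex_intro a (ex_intro b hab) := K_opP (hK k) in ex_intro _ (a, b) hab).
  have [Bh hBh] := @choice _ _ (fun k u => B (g k, u) /\ Bg k = (fun x => - 'i%C * u x))
    (fun k => let: ex_intro2 b h1 h2 := hB k in ex_intro _ b (conj h1 h2)).
  pose a := tensor_val f (fun k => (Af k).1) g Bh.
  pose b := tensor_val f (fun k => (Af k).2) g (fun k x => -1 * Bh k x).
  have hf k : L2C m1 (f k) by have [h _ _] := hAf k; exact: op_L2C_l h.
  have hA1f k : L2C m1 (Af k).1 by have [h _ _] := hAf k; exact: op_L2C_r h.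
  have hg k : L2C m2 (g k) by have [h _] := hBh k; exact: op_L2C_l h.
  have hBg k : L2C m2 (Bh k) by have [h _] := hBh k; exact: op_L2C_r h.
  have ha : L2C m12 a by exact: L2C_tensor_val.
  have Kc0 : K_coef^* != 0 :> R[i] by rewrite conjC_eq0 K_coef_neq0.
  (* [K_op] asks for an exact equality of functions, while [G] is known only almost everywhere; the
     discrepancy is put into the backward summand, whose graph is closed under changes on null
     sets. *)
  pose b' z := (K_coef^*)^-1 * (G z - K_coef * a z).
  have bb' : b' = b %[ae m12].
    apply: filterS e2 => z /[apply] ez; rewrite /b' ez.
    apply: (mulfI Kc0); rewrite mulrA mulfV// mul1r.
    apply/eqP; rewrite subr_eq addrC; apply/eqP.
    rewrite /a /b /tensor_val !mulr_sumr -big_split/=; apply: eq_bigr => k _.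
    have [_ _ ->] := hAf k; have [_ ->] := hBh k; rewrite -K_coef_sub; ring.
  rewrite (_ : G = fun z => K_coef * a z + K_coef^* * b' z); last first.
    by apply/funext => z; rewrite /b' mulrA mulfV// mul1r addrC subrK.
  apply: K_opI.
  + apply: (tensor_sumI (f := f) (Af := fun k => (Af k).1) (g := g) (Bg := Bh)) => //.
    * by move=> k; have [] := hAf k.
    * by move=> k; have [] := hBh k.
    * exact: ae_refl.
  + apply: (tensor_sumI (f := f) (Af := fun k => (Af k).2) (g := g)
      (Bg := fun k x => -1 * Bh k x)) => //.
    * by move=> k; have [] := hAf k.
    * by move=> k; have [h _] := hBh k; exact: scale_opI.
    * by apply: L2CZ; apply: L2CB => //; exact: L2CZ.
Qed.

End tensor.

(** * The phase factor e^(ix) *)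

Section expi.
Context {R : realType}.

Lemma expiNK (x : R) : expi (- x) * expi x = 1.
Proof.
apply: complex_ext; rewrite /expi /= cosN sinN; last by ring.
by have := cos2Dsin2 x; rewrite !expr2 mulNr opprK.
Qed.

Lemma normc_le_ReIm (z : R[i]) : Normc.normc z <= `|complex.Re z| + `|complex.Im z|.
Proof.
case: z => a b /=; rewrite -[leRHS]ger0_norm ?addr_ge0// -sqrtr_sqr.
rewrite ler_wsqrtr// sqrrD !real_normK ?num_real// lerD2r lerDl.
by rewrite mulrn_wge0// mulr_ge0.
Qed.

(** The derivatives of cos and sin give convergence of the two parts, and |z| <= |Re z| + |Im z|
    squeezes the modulus. *)
Lemma expi_difference_quotient (a t : R) :
  Normc.normc ((h^-1)%:C * (expi (a * (t + h)) - expi (a * t)) -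
    'i%C * a%:C * expi (a * t)) @[h --> 0^'] --> (0 : R).
Proof.
have cvg_quot (f : R -> R) (df : R) : is_derive t (1 : R) f df ->
    `|h^-1 * (f (t + h) - f t) - df| @[h --> 0^'] --> (0 : R).
  move=> [f1 f2].
  have lim1 : h^-1 * (f (t + h) - f t) @[h --> 0^'] --> df.
    rewrite -f2; apply: cvg_trans f1; apply: near_eq_cvg; apply: nearW => h.
    change (h^-1 * (f (h * 1 + t) - f t) = h^-1 * (f (t + h) - f t)).
    by rewrite mulr1 [h + t]addrC.
  have lim2 : h^-1 * (f (t + h) - f t) - df @[h --> 0^'] --> (0 : R).
    by have l := cvgB lim1 (cvg_cst df); rewrite subrr in l; exact: l.
  by have l := cvg_norm lim2; rewrite normr0 in l; exact: l.
have da : is_derive t (1 : R) (fun t => a * t) a.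
  by have := is_deriveZ a (is_derive_id t (1 : R)); rewrite /GRing.scale/= mulr1; exact.
have lim_cos := cvg_quot _ _ (is_derive1_comp (is_derive_cos (a * t)) da).
have lim_sin := cvg_quot _ _ (is_derive1_comp (is_derive_sin (a * t)) da).
have cvg_sum (u v : R -> R) : u h @[h --> 0^'] --> (0 : R) -> v h @[h --> 0^'] --> (0 : R) ->
    u h + v h @[h --> 0^'] --> (0 : R).
  by move=> hu hv; rewrite -[X in _ --> X]addr0; exact: cvgD.
have lim_sum := cvg_sum _ _ lim_cos lim_sin.
apply: (squeeze_cvgr _ (cvg_cst (0 : R)) lim_sum); apply: nearW => h; apply/andP; split.
  by case: (_ - _) => x y; exact: sqrtr_ge0.
apply: le_trans (normc_le_ReIm _) _; rewrite le_eqVlt; apply/orP; left; apply/eqP.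
by congr (_ + _); congr (Num.norm _); rewrite /expi /=; ring.
Qed.

End expi.

(** * Doob transform of a tensor sum *)

Section doob_tensor.
Context {R : realType} {d1 d2 : measure_display}
  {T1 : measurableType d1} {T2 : measurableType d2}.
Variables (nu m : {measure set T1 -> \bar R}) (m2 : {sigma_finite_measure set T2 -> \bar R}).
Variables (psi : T1 -> R[i]) (theta theta' : T2 -> R[i]) (E : R).
Hypothesis mpsi : cmeas psi.
Hypothesis mE : forall B, measurable B -> m B = (\int[nu]_(x in B) (sqn (psi x))%:E)%E.
Hypothesis psi_neq0 : \forall x \ae nu, psi x != 0.
Hypothesis mtheta : cmeas theta.
Hypothesis sqn_theta : forall t, sqn (theta t) = 1.
Hypothesis thetaK : forall t, theta' t * theta t = 1.
Let Psi (z : T1 * T2) := psi z.1 * theta z.2.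

Let mPsi : cmeas Psi.
Proof. by apply: cmeasM; [exact: cmeas_fst|exact: cmeas_snd]. Qed.

Let Psi_neq0 : \forall z \ae (nu \x m2)%E, Psi z != 0.
Proof.
apply: filterS (ae_fst m2 psi_neq0) => z psiz; rewrite mulf_neq0//.
by apply/eqP => e; have := thetaK z.2; rewrite e mulr0 => /eqP; rewrite eq_sym oner_eq0.
Qed.

(** Since |theta| = 1, |Psi|^2 = |psi|^2 and the density concerns the space factor alone. *)
Let prod_density (B : set (T1 * T2)) : measurable B ->
  ((m \x m2) B = \int[nu \x m2]_(z in B) (sqn (Psi z))%:E)%E.
Proof.
move=> mB; rewrite [RHS]integral_mkcond epatch_indic ge0_integral_prod; last 2 first.
- apply: emeasurable_funM; first by apply/measurable_EFinP; exact: cmeas_sqn.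
  exact/measurable_EFinP.
- by move=> z; rewrite mule_ge0// lee_fin// sqn_ge0.
rewrite [LHS](@ge0_integral_density _ _ _ nu m (fun x => sqn (psi x)))//; last 3 first.
- exact: cmeas_sqn.
- by move=> x; exact: sqn_ge0.
- exact: measurable_fun_xsection.
apply: eq_integral => x _.
rewrite (@eq_integral _ _ _ m2 setT
  (fun y => (sqn (psi x))%:E * (\1_(xsection B x) y)%:E)%E); last first.
  move=> y _; rewrite /Psi /= sqnM sqn_theta mulr1; congr (_ * (_%:R)%:E)%E.
  by rewrite /xsection; congr nat_of_bool; apply/idP/idP; rewrite !inE/= ?inE.
rewrite ge0_integralZl//; last by rewrite lee_fin sqn_ge0.
  rewrite integral_indic//; first by rewrite setIT muleC.
  exact: measurable_xsection.
by apply/measurable_EFinP; apply: measurable_indic; exact: measurable_xsection.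
Qed.

Variables (K : oper R T1) (D : oper R T2).
Hypotheses (opK : is_operator m K) (opD : is_operator m2 D).
Hypothesis D_theta : forall h Dh, D (h, Dh) ->
  D (fun t => h t * theta t, fun t => (Dh t - 'i%C * E%:C * h t) * theta t).
Hypothesis D_theta' : forall h Dh, D (h, Dh) ->
  D (fun t => h t * theta' t, fun t => (Dh t + 'i%C * E%:C * h t) * theta' t).

Let i2 : 'i%C * 'i%C = -1 :> R[i]. Proof. by rewrite -expr2 sqr_i. Qed.

(** Time factors are multiplied by [theta] in one inclusion and by its inverse [theta'] in the
    other. Applied to h theta, - i D yields (- i D h - E h) theta, and the term - E h is compensated
    by the + E of [shift_op] on the space factor. *)
Lemma doob_tensor :
  doob_transform (nu \x m2)%E Psi (tensor_sum m m2 K (scale_op (- 'i%C) D)) =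
  tensor_sum nu m2 (shift_op (doob_transform nu psi K) E) (scale_op (- 'i%C) D).
Proof.
have opDK := is_operator_doob mpsi mE psi_neq0 opK.
apply/seteqP; split => [[F G]|[F G]].
- move=> FG; have [hF hG] := ae_closure_L2C FG.
  have [f [g [fg Ff Gg]]] := doobP FG.
  have [r [phi [Kphi [h [Bh [hK hB fE gE]]]]]] := tensor_sumP fg.
  have fE' := density_ae mPsi prod_density Psi_neq0 fE.
  have gE' := density_ae mPsi prod_density Psi_neq0 gE.
  have [Dh hD] := @choice _ _ (fun k u => D (h k, u) /\ Bh k = (fun x => - 'i%C * u x))
    (fun k => let: ex_intro2 b h1 h2 := hB k in ex_intro _ b (conj h1 h2)).
  apply: (tensor_sumI (f := fun k x => phi k x * psi x)
    (Af := fun k x => Kphi k x * psi x + E%:C * (phi k x * psi x))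
    (g := fun k t => h k t * theta t)
    (Bg := fun k t => - 'i%C * ((Dh k t - 'i%C * E%:C * h k t) * theta t))) => //.
  + move=> k; apply: shift_opI; exact: (doobI mpsi mE opK (hK k)).
  + by move=> k; apply/scale_opI/D_theta; have [] := hD k.
  + apply: (ae_impl2 _ Ff fE') => z /(_ I) -> /(_ I) -> _.
    by rewrite /tensor_elt mulr_suml; apply: eq_bigr => k _; rewrite /Psi; ring.
  + apply: (ae_impl2 _ Gg gE') => z /(_ I) -> /(_ I) -> _.
    rewrite /tensor_val mulr_suml; apply: eq_bigr => k _; rewrite /Psi.
    have [_ ->] := hD k.
    have -> : - 'i%C * ((Dh k z.2 - 'i%C * E%:C * h k z.2) * theta z.2) =
      (- 'i%C * Dh k z.2 + 'i%C * 'i%C * E%:C * h k z.2) * theta z.2 by ring.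
    by rewrite i2; ring.
- move=> FG; have [hF hG] := ae_closure_L2C FG.
  have [r [u [v [g [Bg [hH hB FE GE]]]]]] := tensor_sumP FG.
  have hu k : exists w : (T1 -> R[i]) * (T1 -> R[i]), [/\ K (w.1, w.2),
      u k = (fun x => w.1 x * psi x) %[ae nu] &
      v k = (fun x => w.2 x * psi x + E%:C * (w.1 x * psi x)) %[ae nu]].
    have [v' Dv ->] := shift_opP (hH k); have [phi [Kphi [hK e1 e2]]] := doobP Dv.
    exists (phi, Kphi); split => //.
    exact: (ae_map2 (fun a b => a + E%:C * b) e2 e1).
  have [w hw] := choice hu.
  have [Dg hD] := @choice _ _ (fun k u => D (g k, u) /\ Bg k = (fun x => - 'i%C * u x))
    (fun k => let: ex_intro2 b h1 h2 := hB k in ex_intro _ b (conj h1 h2)).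
  pose phi k := (w k).1; pose Kphi k := (w k).2.
  pose h k t := g k t * theta' t.
  pose Dh k t := (Dg k t + 'i%C * E%:C * g k t) * theta' t.
  have hK k : K (phi k, Kphi k) by have [] := hw k.
  have hDh k : D (h k, Dh k) by apply: D_theta'; have [] := hD k.
  pose f := tensor_elt phi h; pose Kf := tensor_val phi Kphi h (fun k t => - 'i%C * Dh k t).
  have fKf : tensor_sum m m2 K (scale_op (- 'i%C) D) (f, Kf).
    apply: (tensor_sumI (f := phi) (Af := Kphi) (g := h)
      (Bg := fun k t => - 'i%C * Dh k t)) => //; try exact: ae_refl.
    + by move=> k; exact: scale_opI.
    + apply: L2C_tensor_elt => k; [exact: op_L2C_l opK (hK k)|exact: op_L2C_l opD (hDh k)].
    + apply: L2C_tensor_val => k; [exact: op_L2C_l opK (hK k)|exact: op_L2C_r opK (hK k)|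
        exact: op_L2C_l opD (hDh k)|by apply: L2CZ; exact: op_L2C_r opD (hDh k)].
  have hu1 : \forall z \ae (nu \x m2)%E, forall k, u k z.1 = phi k z.1 * psi z.1.
    have hu0 : \forall x \ae nu, forall k, u k x = phi k x * psi x.
      apply: ae_forall_ord => k; have [_ + _] := hw k.
      by apply: filterS => x /(_ I).
    exact: (ae_fst m2 hu0).
  have hv1 : \forall z \ae (nu \x m2)%E, forall k,
      v k z.1 = Kphi k z.1 * psi z.1 + E%:C * (phi k z.1 * psi z.1).
    have hv0 : \forall x \ae nu, forall k,
        v k x = Kphi k x * psi x + E%:C * (phi k x * psi x).
      apply: ae_forall_ord => k; have [_ _] := hw k.
      by apply: filterS => x /(_ I).
    exact: (ae_fst m2 hv0).
  split => //=; exists (fun z => f z * Psi z), (fun z => Kf z * Psi z); split.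
  + by exists f, Kf.
  + apply: (ae_impl2 _ FE hu1) => z /(_ I) -> hz _.
    rewrite /f /tensor_elt mulr_suml; apply: eq_bigr => k _.
    by rewrite hz /h /Psi -[LHS]mulr1 -(thetaK z.2); ring.
  + have huv := ae_impl2 (fun z => @conj _ _) hu1 hv1.
    apply: (ae_impl2 _ GE huv) => z /(_ I) -> [hz hz'] _.
    rewrite /Kf /tensor_val mulr_suml; apply: eq_bigr => k _.
    have [_ ->] := hD k; rewrite hz hz' /h /Dh /Psi -[LHS]mulr1 -(thetaK z.2).
    have -> : - 'i%C * ((Dg k z.2 + 'i%C * E%:C * g k z.2) * theta' z.2) =
      (- 'i%C * Dg k z.2 - 'i%C * 'i%C * E%:C * g k z.2) * theta' z.2 by ring.
    by rewrite i2; ring.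
Qed.

End doob_tensor.

Lemma doob_tensor_time_deriv {R : realType} {d : measure_display} {T : measurableType d}
    (nu m : {measure set T -> \bar R}) (psi : T -> R[i]) (E : R) (K : oper R T) :
  cmeas psi ->
  (forall B, measurable B -> m B = \int[nu]_(x in B) (sqn (psi x))%:E)%E ->
  (\forall x \ae nu, psi x != 0) -> is_operator m K ->
  let Psi := fun z : T * R => psi z.1 * expi (- (E * z.2)) in
  doob_transform (nu \x @lebesgue_measure R)%E Psi
    (tensor_sum m (@lebesgue_measure R) K (scale_op (- 'i%C) time_deriv)) =
  tensor_sum nu (@lebesgue_measure R) (shift_op (doob_transform nu psi K) E)
    (scale_op (- 'i%C) time_deriv).
Proof.
move=> mpsi psiE psi_neq0 opK Psi; pose theta' (t : R) := expi (E * t).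
have mtheta : @cmeas R _ (measurableTypeR R) (fun t => expi (- (E * t))).
  by apply: cmeas_expi; apply: measurableT_comp => //; exact: measurable_funM.
have thetaK t : theta' t * expi (- (E * t)) = 1 by rewrite mulrC expiNK.
apply: (@doob_tensor R d _ T _ nu m (@lebesgue_measure R) psi _ theta' E mpsi psiE psi_neq0
  mtheta _ thetaK K time_deriv opK is_operator_time_deriv).
- by move=> t; exact: sqn_expi.
- move=> h Dh /(time_deriv_expi (- E)); congr (time_deriv (_, _)); apply/funext => t.
    by rewrite mulNr.
  by rewrite mulNr rmorphN /= mulrN mulNr.
- by move=> h Dh /(time_deriv_expi E).
Qed.

(** Needed to see that psi is not the zero vector: being nonzero almost everywhere, it could vanish
    almost everywhere only if the whole space were null. *)
Lemma lebesgue_tuple_gt0 (R : realType) (n : nat) :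
  (0 < lebesgue_tuple n [set: n.-tuple R])%E.
Proof.
elim: n => [|n IH]; first by rewrite /= diracT.
rewrite /= /pushforward preimage_setT -setXTT product_measure1E// mule_gt0//.
apply: (@lt_le_trans _ _ (@lebesgue_measure R (ball (0 : R) 1))).
  by rewrite lebesgue_measure_ball// lte_fin.
apply: (@le_measure _ _ _ (@lebesgue_measure R)) => //; rewrite inE//.
exact: measurable_ball.
Qed.

Theorem proposition5p2 (R : realType) (n : nat)
    (dO : measure_display) (Omega : measurableType dO)
    (P : {measure set Omega -> \bar R}) (X : R -> Omega -> n.-tuple R)
    (p q : transition_function R (n.-tuple R))
    (mu : {measure set (n.-tuple R) -> \bar R}) (rho : n.-tuple R -> R)
    (C : R) (S : n.-tuple R -> R) (E : R) :
  let dx := lebesgue_tuple n in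
  let dt := @lebesgue_measure R in
  let L := complexify (generator mu p) in
  let Lt := complexify (generator mu q) in
  is_markov_process P X p q ->
  one_time_marginal P X mu ->
  (* hypothesis 1 *)
  invariant_measure p q mu ->
  measurable_fun setT rho -> (forall x, 0 <= rho x) ->
  (forall B, measurable B -> mu B = \int[dx]_(x in B) (rho x)%:E)%E ->
  (* hypothesis 2 *)
  (\forall x \ae dx, 0 < rho x) ->
  (* hypothesis 3 *)
  dense_in_L2 mu (generator_dom mu p `&` generator_dom mu q) ->
  (* hypothesis 4 *)
  (forall phi Lphi, L (phi, Lphi) ->
    C * fine (norm2 mu phi) ^+ 2
      <= - complex.Re (inner mu phi Lphi) + complex.Im (inner mu phi Lphi)) ->
  measurable_fun setT S ->
  let psi := fun x => (Num.sqrt (rho x))%:C * expi (S x) in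
  let Psi := fun z : n.-tuple R * R => psi z.1 * expi (- (E * z.2)) in
  let LY := tensor_sum mu dt L time_deriv in
  let LtY := tensor_sum mu dt Lt (scale_op (-1) time_deriv) in
  let K := K_op L Lt in
  let KY := K_op LY LtY in
  let K_psi := doob_transform dx psi K in
  let KY_Psi := doob_transform (dx \x dt)%E Psi KY in
  let H0 := shift_op K_psi E in
  let H := friedrichs dx H0 in
  [/\ KY_Psi = tensor_sum dx dt H0 (scale_op (- 'i%C) time_deriv),
      symmetric_operator dx H0,
      bounded_below dx H0 &
      (mu setT < +oo)%E ->
      [/\ eigenvector dx H E psi,
          strong_schroedinger_solution dx H (fun t x => Psi (x, t)) &
          forall t : R, 0 < t ->
            H (fun x => Psi (x, t), fun x => E%:C * Psi (x, t))]].
Proof.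
move=> dx dt L Lt markov marg inv mrho rho0 mE rho_gt0 dense hyp4 mS.
move=> psi Psi LY LtY K KY K_psi KY_Psi H0 H.
have gp : is_real_operator mu (generator mu p).
  by apply: is_real_operator_generator => t B t0 mB; have [] := inv t B t0 mB.
have gq : is_real_operator mu (generator mu q).
  by apply: is_real_operator_generator => t B t0 mB; have [] := inv t B t0 mB.
have opL : is_operator mu L by exact: is_operator_complexify.
have opLt : is_operator mu Lt by exact: is_operator_complexify.
have opK : is_operator mu K by exact: is_operator_K.
have adj f Af g Bg : L (f, Af) -> Lt (g, Bg) -> inner mu Af g = inner mu f Bg.
  exact: (complexify_adjoint gp gq (generator_duality markov marg)).
have sqn_psi x : sqn (psi x) = rho x.
  by rewrite sqnM sqn_expi mulr1 /sqn /= expr0n/= addr0 sqr_sqrtr.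
have mpsi : cmeas psi.
  apply: cmeasM; last exact: cmeas_expi.
  by apply: cmeas_real; apply: measurableT_comp mrho; apply: continuous_measurable_fun;
    exact: sqrt_continuous.
have psiE B : measurable B -> mu B = (\int[dx]_(x in B) (sqn (psi x))%:E)%E.
  by move=> mB; rewrite mE//; apply: eq_integral => x _; rewrite sqn_psi.
have psi_neq0 : \forall x \ae dx, psi x != 0.
  apply: filterS rho_gt0 => x rhox; apply/eqP => e.
  by move: rhox; rewrite -sqn_psi e /sqn /= expr0n/= addr0 ltxx.
have symK : symmetric_operator dx K_psi.
  apply: (symmetric_doob mpsi psiE psi_neq0 opK).
  - by apply: dense_complexify dense => f g [].
  - by move=> f Af g Ag; exact: (inner_K opL opLt adj).
have opK_psi : is_operator dx K_psi by case: symK.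
have bddK : bounded_below dx K_psi.
  apply: (bounded_below_doob mpsi psiE psi_neq0 opK); exists C => f Kf Kff.
  have [a [b [Lfa _ _]]] := K_opP Kff.
  by rewrite (Re_inner_K opL opLt adj Kff Lfa); exact: hyp4.
have symH0 : symmetric_operator dx H0 by exact: symmetric_shift.
have opH0 : is_operator dx H0 by case: symH0.
split => //.
- rewrite /KY_Psi /KY /LY /LtY (K_op_tensor opL opLt is_operator_time_deriv).
  exact: (doob_tensor_time_deriv E mpsi psiE psi_neq0 opK).
- exact: bounded_below_shift.
(* The squared norm of psi in L^2(dx) is the total mass of [mu], so this is what makes psi an
   element of the space. *)
move=> mu_fin.
have H0psi : H0 (psi, fun x => E%:C * psi x).
  have L1 : L (fun=> 1, fun=> 0) by split; exact: generator_cst.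
  have Lt1 : Lt (fun=> 1, fun=> 0) by split; exact: generator_cst.
  have := shift_opI E (doobI mpsi psiE opK (K_opI L1 Lt1)).
  congr (H0 (_, _)); apply/funext => x; first by rewrite mul1r.
  by rewrite !mulr0 addr0 mul0r add0r mul1r.
(* The scaling takes place in [H0], where linearity has been established, and is carried to [H] by
   extension. With c = e^(-iEt) it covers Psi(., t). *)
have Hpsi (c : R[i]) : H (fun x => psi x * c, fun x => E%:C * (psi x * c)).
  have /(friedrichs_extends symH0) := opZ c opH0 H0psi.
  by congr (H (_, _)); apply/funext => x; ring.
have hpsi : L2C dx psi by exact: op_L2C_l opH0 H0psi.
split.
- split; first by exact: friedrichs_extends.
  move=> psi0; have : \forall x \ae dx, False.
    by apply: (ae_impl2 _ psi_neq0 psi0) => x /eqP psix /(_ I).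
  move=> [N [mN N0 hN]]; have NT : N = setT by apply/seteqP; split => // x _; exact: hN.
  by have := lebesgue_tuple_gt0 R n; rewrite -NT -/dx N0 ltxx.
- move=> t; split; first by have [[]] := Hpsi (expi (- (E * t))).
  (* The time derivative is - i E Psi, and i times it is E Psi = H Psi. *)
  exists (fun x => - 'i%C * E%:C * Psi (x, t)); split; last first.
    have := Hpsi (expi (- (E * t))); congr (H (_, _)); apply/funext => x.
    have i2 : 'i%C * 'i%C = -1 :> R[i] by rewrite -expr2 sqr_i.
    rewrite (_ : 'i%C * _ = - ('i%C * 'i%C) * E%:C * Psi (x, t)); last by ring.
    by rewrite i2 opprK mul1r.
  split.
    apply: L2CZ; have := L2CZ (expi (- (E * t))) hpsi.
    by congr L2C; apply/funext => x; rewrite mulrC.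
  (* The error of the difference quotient of Psi is a scalar c(h) times psi, so its L^2 norm is
     |c(h)| times that of psi, and convergence reduces to the scalar phase. *)
  pose c h := (h^-1)%:C * (expi (- E * (t + h)) - expi (- E * t)) -
    'i%C * (- E)%:C * expi (- E * t) : R[i].
  have lim_c : ((Normc.normc (c h))%:E * norm2 dx psi)%E @[h --> 0^'] --> (0 * norm2 dx psi)%E.
    apply: cvgeZr; first exact: norm2_fin_num.
    by apply: cvg_EFin; [exact: nearW|exact: expi_difference_quotient].
  rewrite mul0e in lim_c; apply: cvg_trans lim_c; apply: near_eq_cvg; apply: nearW => h.
  rewrite -norm2Z//; congr norm2; apply/funext => x.
  by rewrite /c /Psi /= !mulNr rmorphN/=; ring.
- by move=> t _; exact: (Hpsi (expi (- (E * t)))).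
Qed.
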